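(* Let $N\ge 1$ and let $P(z)=\sum_{m=0}^N p_m z^m$ be a polynomial with real coefficients $p_m\ge 0$ and $p_N>0$, with roots $\zeta_1,\dots,\zeta_N$ (listed with multiplicity). Let $z_0>0$ and let $X$ be a random variable with $\Pr\{X=m\}=p_m z_0^m/P(z_0)$ for $m=0,\dots,N$. For $x\in\mathbb{R}$ put $$F(x)=\Pr\Big\{\frac{X-E[X]}{\sqrt{\operatorname{Var}(X)}}\le x\Big\},\qquad G(x)=(2\pi)^{-1/2}\int_{-\infty}^x e^{-u^2/2}\,du.$$ Suppose there is $\delta>0$ such that $z_0\ge\delta$ and $|z_0-\zeta_j|\ge\delta$ for all $j=1,\dots,N$. Then there exist constants $N_0,B_1,B_2>0$, depending only on $\delta$ and $z_0$, such that if $N\ge N_0$ then $$\sup_{x\in\mathbb{R}}|F(x)-G(x)|\le \frac{B_1N}{\operatorname{Var}(X)^{3/2}}+\frac{B_2N^{1/3}}{\operatorname{Var}(X)^{1/2}}.$$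
   Context: $G$ is the standard normal distribution function; the constants $N_0,B_1,B_2$ do not depend on $N$ or on the particular coefficients of $P$. *)

(* Defs.v *)
From HB Require Import structures.
From mathcomp Require Import all_boot all_order all_algebra.
From mathcomp Require Import complex.
From mathcomp Require Import all_classical all_reals all_analysis.
Set Implicit Arguments.
Unset Strict Implicit.
Unset Printing Implicit Defensive.
Import Order.TTheory GRing.Theory Num.Theory.
Import numFieldNormedType.Exports.
Local Open Scope classical_set_scope.
Local Open Scope ring_scope.

(* The random variables considered here have finite support, so [fine] loses
   nothing in [mean] and [var]. *)
Definition mean (R : realType) (d : measure_display) (T : measurableType d)
  (Pr : probability T R) (X : T -> R) : R := fine ('E_Pr[X])%E.

Definition var (R : realType) (d : measure_display) (T : measurableType d)
  (Pr : probability T R) (X : T -> R) : R := fine (variance Pr X).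

(* Meaningful only when [var Pr X] is nonzero, since division by 0 returns 0. *)
Definition std_cdf (R : realType) (d : measure_display) (T : measurableType d)
  (Pr : probability T R) (X : T -> R) (x : R) : R :=
  fine (Pr [set w | (X w - mean Pr X) / Num.sqrt (var Pr X) <= x]).

Definition gauss_cdf (R : realType) (x : R) : R :=
  (Num.sqrt (2 * pi))^-1 *
  \int[lebesgue_measure]_(u in `]-oo, x]) expR (- u ^+ 2 / 2).

(* [zeta] lists the complex roots of [P], with multiplicity. *)
Definition complex_roots (R : realType) (N : nat) (P : {poly R})
  (zeta : 'I_N -> R[i]) : Prop :=
  map_poly (real_complex R) P =
  (lead_coef P)%:C%C *: \prod_(j < N) ('X - (zeta j)%:P).

(* Main.v *)
Require Import Defs.
From HB Require Import structures.
From mathcomp Require Import all_boot all_order all_algebra.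
From mathcomp Require Import complex ring lra.
From mathcomp Require Import all_classical all_reals all_analysis.
From mathcomp Require Import measurable_realfun.
Import Order.TTheory GRing.Theory Num.Theory.
Import numFieldNormedType.Exports Normc.
Local Open Scope classical_set_scope.
Local Open Scope ring_scope.
Set Implicit Arguments.
Unset Strict Implicit.
Unset Printing Implicit Defensive.

(* Let [s^2] be the variance of [X], let [L = N / s^3], and write
   [q_j = z0 / (z0 - zeta_j)], which is bounded by [kappa = z0 / delta].  The
   factorisation of [P] makes [E e^(itX) = prod_j (1 + q_j (e^(it) - 1))], so [X]
   behaves like a sum of Bernoulli variables with complex parameters: the mean is
   [sum_j q_j], the variance is [sum_j q_j (1 - q_j)], and the centred
   characteristic function [chi] solves [chi' = (- s^2 t + rho) chi] with
   [|rho| <= K N t^2] for small [t].  Comparing with the Gaussian equation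
   gives, for the standardised variable [Y] and a standard normal [Z],
   [|E cos (t (Y - a)) - E cos (t (Z - a))| <= K L t^3 exp (- t^2 / 4)] as long as
   [t <= 1 / (2 K L)].

   Since [c |y|] is the integral of [(1 - cos (t y)) / t^2] over [t > 0], this
   bounds [E |Y - a| - E |Z - a|] by a multiple of [L], uniformly in [a].  The
   difference quotient [(|y - x - h| - |y - x|) / h] is a ramp approximating the
   indicator of [y <= x], whence [|F - G| <= h + C L / h] for every [h > 0].  Taking
   [h = L^(1/3)] gives [O(L^(1/3))] when [L <= 1], which is the second term of the
   bound; when [L > 1] that term already exceeds [1]. *)

(** * Derivatives and Taylor bounds *)

Section real_derivatives.
Context {R : realType}.
Implicit Types (f g : R -> R) (x c : R).

Lemma is_derive_add {f g x df dg} : is_derive x 1 f df -> is_derive x 1 g dg ->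
  is_derive x 1 (fun y => f y + g y) (df + dg).
Proof. exact: is_deriveD. Qed.

Lemma is_derive_opp {f x df} : is_derive x 1 f df ->
  is_derive x 1 (fun y => - f y) (- df).
Proof. exact: is_deriveN. Qed.

Lemma is_derive_mul {f g x df dg} : is_derive x 1 f df -> is_derive x 1 g dg ->
  is_derive x 1 (fun y => f y * g y) (f x * dg + g x * df).
Proof. exact: is_deriveM. Qed.

Lemma is_derive_const c x : is_derive x 1 (fun _ : R => c) 0.
Proof. exact: is_derive_cst. Qed.

Lemma is_derive_var x : is_derive x 1 (fun y : R => y) 1.
Proof. exact: is_derive_id. Qed.

Lemma is_derive_exp {f x df} : is_derive x 1 f df ->
  is_derive x 1 (fun y => expR (f y)) (expR (f x) * df).
Proof. by move=> h; apply: (@is_derive1_comp _ expR f). Qed.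

Lemma is_derive_cosf {f x df} : is_derive x 1 f df ->
  is_derive x 1 (fun y => cos (f y)) (- sin (f x) * df).
Proof. by move=> h; apply: (@is_derive1_comp _ cos f). Qed.

Lemma is_derive_sinf {f x df} : is_derive x 1 f df ->
  is_derive x 1 (fun y => sin (f y)) (cos (f x) * df).
Proof. by move=> h; apply: (@is_derive1_comp _ sin f). Qed.

Lemma is_derive_bigsum n (f : 'I_n -> R -> R) x (df : 'I_n -> R) :
  (forall i, is_derive x 1 (f i) (df i)) ->
  is_derive x 1 (fun y => \sum_(i < n) f i y) (\sum_(i < n) df i).
Proof.
move=> h; have := is_derive_sum h.
by congr is_derive; apply/funext => y; rewrite fct_sumE.
Qed.

Lemma is_derive_continuous {f} {df : R -> R} :
  (forall x, is_derive x 1 f (df x)) -> continuous f.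
Proof.
by move=> h x; apply/differentiable_continuous/derivable1_diffP; case: (h x).
Qed.

Lemma is_derive_ge0_le {f} {df : R -> R} {a b : R} : a <= b ->
  (forall x, is_derive x 1 f (df x)) ->
  (forall x, a <= x <= b -> 0 <= df x) -> f a <= f b.
Proof.
move=> ab h df0.
have cf : {within `[a, b], continuous f}.
  by apply: continuous_subspaceT; exact: is_derive_continuous h.
have [c cab E] := @MVT_segment R f df a b ab (fun x _ => h x) cf.
by rewrite -subr_ge0 E mulr_ge0 ?subr_ge0 ?df0// -in_itv.
Qed.

End real_derivatives.

(* Typeclass resolution would commit to the library's pointfree instances
   and leave derivatives in terms of [*:]. *)
Ltac solve_derive :=
  repeat first
    [ match goal with H : forall x : _, is_derive x _ _ _ |- _ =>
        notypeclasses refine (H _) end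
    | notypeclasses refine (is_derive_const _ _)
    | notypeclasses refine (is_derive_var _)
    | notypeclasses refine (is_derive_add _ _)
    | notypeclasses refine (is_derive_opp _)
    | notypeclasses refine (is_derive_mul _ _)
    | notypeclasses refine (is_derive_exp _)
    | notypeclasses refine (is_derive_cosf _)
    | notypeclasses refine (is_derive_sinf _) ].

Ltac derive_eq := notypeclasses refine (is_derive_eq _ _).

Section taylor.
Context {R : realType}.
Implicit Types x t : R.

Lemma sin_le_id t : 0 <= t -> sin t <= t.
Proof.
move=> t0; rewrite -subr_ge0 -[leLHS](_ : 0 - sin 0 = 0); last by rewrite sin0 subr0.
apply: (@is_derive_ge0_le _ (fun y => y - sin y) (fun y => 1 - cos y * 1)) => //.
by move=> x; solve_derive.
Qed.

Lemma one_sub_cos_le t : 0 <= t -> 1 - cos t <= t ^+ 2 / 2.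
Proof.
move=> t0; rewrite -subr_ge0.
(* Squares are spelled as products inside the auxiliary functions because [solve_derive]
   differentiates products, not powers. *)
rewrite -[leLHS](_ : 0 * 0 / 2 - (1 - cos 0) = 0 :> R); last by rewrite cos0; lra.
apply: (@is_derive_ge0_le _ (fun y => y * y / 2 - (1 - cos y))
  (fun y => y - sin y)) => //.
  by move=> x; derive_eq; [solve_derive|cbv beta; lra].
by move=> x /andP[x0 _]; rewrite subr_ge0 sin_le_id.
Qed.

Lemma id_sub_sin_le t : 0 <= t -> t - sin t <= t ^+ 2 / 2.
Proof.
move=> t0; rewrite -subr_ge0.
rewrite -[leLHS](_ : 0 * 0 / 2 - (0 - sin 0) = 0 :> R); last by rewrite sin0; lra.
apply: (@is_derive_ge0_le _ (fun y => y * y / 2 - (y - sin y))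
  (fun y => y - (1 - cos y))) => //.
  by move=> x; derive_eq; [solve_derive|cbv beta; lra].
move=> x /andP[x0 _]; have := one_sub_cos_le x0; have := cos_geN1 x.
(* Up to [2] the quadratic bound gives [1 - cos x <= x ^+ 2 / 2 <= x]; beyond [2] the trivial bound
   [1 - cos x <= 2] is enough. *)
by have [?|?] := leP x 2; nra.
Qed.

Lemma expR_sub1_le x : expR x - 1 <= x * expR x.
Proof.
have := expR_ge1Dx (- x); rewrite expRN => h.
have e0 := expR_gt0 x.
have : (1 - x) * expR x <= 1 by rewrite -ler_pdivlMr// div1r.
lra.
Qed.

End taylor.

(** * Perturbation of the Gaussian differential equation *)

Section gaussian_ode.
Context {R : realType}.
Variables (A B dA dB : R -> R) (s k tau : R).
Hypothesis k0 : 0 <= k.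
Hypothesis A' : forall x : R, is_derive x 1 A (dA x).
Hypothesis B' : forall x : R, is_derive x 1 B (dB x).
Hypotheses (A0 : A 0 = 1) (B0 : B 0 = 0).
Hypothesis ode : forall t, 0 <= t <= tau ->
  (dA t + s * t * A t) ^+ 2 + (dB t + s * t * B t) ^+ 2 <=
  (k * t ^+ 2) ^+ 2 * (A t ^+ 2 + B t ^+ 2).

(** Read [A + iB] as a complex function [chi]. Then [|chi|^2 exp (s t^2 - 2 k t^3 / 3)] starts at
    [1] and is nonincreasing, because the derivative of [|chi|^2] is [2 Re (conj chi * chi')] and
    [ode] bounds [|chi' + s t chi|] by [k t^2 |chi|]. *)
Lemma gaussian_ode_modulus t : 0 <= t <= tau ->
  (A t ^+ 2 + B t ^+ 2) * expR (s * t ^+ 2) <= expR (2 / 3 * k * t ^+ 3).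
Proof.
move=> /andP[t0 tt].
pose e y := expR (s * (y * y) - 2 / 3 * k * (y * y * y)).
pose f y := - ((A y * A y + B y * B y) * e y).
pose df y := 2 * e y * (k * y ^+ 2 * (A y ^+ 2 + B y ^+ 2) -
   (A y * (dA y + s * y * A y) + B y * (dB y + s * y * B y))).
have : f 0 <= f t.
  apply: (@is_derive_ge0_le _ f df _ _ t0).
    move=> x; derive_eq; first by rewrite /f /e; solve_derive.
    by rewrite /df /e; cbv beta; field.
  move=> x /andP[x0 xt]; rewrite /df; apply: mulr_ge0.
    by rewrite mulr_ge0// expR_ge0.
  have /ode h : 0 <= x <= tau by rewrite x0 (le_trans xt).
  rewrite subr_ge0; set a := dA x + _ in h *; set b := dB x + _ in h *.
  set r := A x ^+ 2 + B x ^+ 2 in h *.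
  have r0 : 0 <= r by rewrite addr_ge0// sqr_ge0.
  have kx : 0 <= k * x ^+ 2 by rewrite mulr_ge0// sqr_ge0.
  apply: (le_trans (ler_norm _)).
  rewrite -(@ler_pXn2r _ 2)// ?nnegrE ?mulr_ge0//.
  rewrite real_normK ?num_real// exprMn.
  (* Cauchy-Schwarz in the plane, through Lagrange's identity: the defect is the square of
     [A x * b - B x * a]. *)
  apply: (@le_trans _ _ (r * (a ^+ 2 + b ^+ 2))).
    have := sqr_ge0 (A x * b - B x * a); rewrite /r; lra.
  by rewrite [_ * r ^+ 2]mulrC expr2 -mulrA ler_wpM2l// mulrC.
rewrite /f /e A0 B0 !(mulr0, mul0r) subr0 expR0 !mulr1 addr0 lerN2.
rewrite expRB mulrA ler_pdivrMr ?expR_gt0// mul1r.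
by congr (_ <= _); rewrite ?expr2// !exprS expr0 mulr1 !mulrA.
Qed.

(** The unit vector [(a, b)] selects the component [Re (conj (a + ib) * chi)]. Multiplied by
    [exp (s t^2 / 2)], this component has derivative at most [k t^2 |chi| exp (s t^2 / 2)], hence by
    [gaussian_ode_modulus] at most [k t^2 exp (k t^3 / 3)], which is the derivative of
    [exp (k t^3 / 3)]. *)
Lemma gaussian_ode_dist a b t : 0 <= t <= tau -> a ^+ 2 + b ^+ 2 = 1 ->
  `|a * A t + b * B t - a * expR (- (s * t ^+ 2 / 2))| <=
  expR (- (s * t ^+ 2 / 2)) * (expR (k * t ^+ 3 / 3) - 1).
Proof.
move=> /andP[t0 tt].
(* A one-sided bound suffices: the other side is the same bound for the opposite unit vector. *)
suff H c d : c ^+ 2 + d ^+ 2 = 1 ->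
    c * A t + d * B t - c * expR (- (s * t ^+ 2 / 2)) <=
    expR (- (s * t ^+ 2 / 2)) * (expR (k * t ^+ 3 / 3) - 1).
  move=> ab1; rewrite ler_norml H// andbT.
  have := H (- a) (- b); rewrite !sqrrN => /(_ ab1).
  by rewrite lerNl; congr (_ <= _); ring.
move=> cd1.
pose f y := expR (k * (y * y * y) / 3) -
  (c * A y + d * B y) * expR (s * (y * y) / 2).
pose df y := k * y ^+ 2 * expR (k * (y * y * y) / 3) -
  (c * (dA y + s * y * A y) + d * (dB y + s * y * B y)) * expR (s * (y * y) / 2).
have : f 0 <= f t.
  apply: (@is_derive_ge0_le _ f df _ _ t0).
    move=> x; derive_eq; first by rewrite /f; solve_derive.
    by rewrite /df; cbv beta; field.
  move=> x /andP[x0 xt]; rewrite /df subr_ge0.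
  have xx : 0 <= x <= tau by rewrite x0 (le_trans xt).
  have h := ode xx; have m := gaussian_ode_modulus xx.
  set p := dA x + _ in h *; set q := dB x + _ in h *.
  set r := A x ^+ 2 + B x ^+ 2 in h m *.
  have kx : 0 <= k * x ^+ 2 by rewrite mulr_ge0// sqr_ge0.
  apply: (le_trans (ler_norm _)).
  rewrite -(@ler_pXn2r _ 2)// ?nnegrE ?mulr_ge0 ?expR_ge0//.
  rewrite real_normK ?num_real// [leLHS]exprMn [leRHS]exprMn -!expRM_natl.
  apply: (@le_trans _ _ ((p ^+ 2 + q ^+ 2) * expR (2 * (s * (x * x) / 2)))).
    rewrite ler_wpM2r ?expR_ge0//.
    have -> : p ^+ 2 + q ^+ 2 = (c ^+ 2 + d ^+ 2) * (p ^+ 2 + q ^+ 2).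
      by rewrite cd1 mul1r.
    by have := sqr_ge0 (c * q - d * p); lra.
  apply: (@le_trans _ _ ((k * x ^+ 2) ^+ 2 * r * expR (2 * (s * (x * x) / 2)))).
    by rewrite ler_wpM2r ?expR_ge0.
  rewrite -mulrA ler_wpM2l ?sqr_ge0//.
  have -> : 2 * (s * (x * x) / 2) = s * x ^+ 2 by field.
  by have -> : 2 * (k * (x * x * x) / 3) = 2 / 3 * k * x ^+ 3 by field.
rewrite /f A0 B0 !(mulr0, mul0r, addr0) expR0 !mulr1.
have -> : k * (t * t * t) / 3 = k * t ^+ 3 / 3 by ring.
have -> : s * (t * t) / 2 = s * t ^+ 2 / 2 by ring.
rewrite expRN; set E := expR (s * _ / 2); set F := expR (k * _ / 3).
have E0 : 0 < E by exact: expR_gt0.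
move=> h; rewrite -(ler_pM2r E0).
have E1 : E^-1 * E = 1 by rewrite mulVf ?gt_eqF.
have -> : E^-1 * (F - 1) * E = (F - 1) * (E^-1 * E) by ring.
have -> : (c * A t + d * B t - c * E^-1) * E =
  (c * A t + d * B t) * E - c * (E^-1 * E) by ring.
rewrite E1; lra.
Qed.

End gaussian_ode.

(** * The characteristic function of the weights *)

Section log_derivative.
Variables (F : fieldType) (I : eqType) (zeta : I -> F).

(** The logarithmic derivative of the product is [s], so its second derivative divided by itself is
    [s ^+ 2] plus the derivative of [s]. Induction on the factors proves both identities together
    without differentiating a rational function. *)
Lemma horner_deriv_prod_XsubC (r : seq I) z : {in r, forall i, z != zeta i} ->
  let Q := \prod_(i <- r) ('X - (zeta i)%:P) in
  let s := \sum_(i <- r) (z - zeta i)^-1 in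
  Q^`().[z] = Q.[z] * s /\
  Q^`()^`().[z] = Q.[z] * (s ^+ 2 - \sum_(i <- r) (z - zeta i) ^- 2).
Proof.
elim: r => [_|i r IH h] /=.
  by rewrite !big_nil -polyC1 derivC deriv0 horner0 expr2 !mulr0 subrr mulr0.
have /IH[E1 E2] : {in r, forall i, z != zeta i}.
  by move=> j jr; apply: h; rewrite inE jr orbT.
have zi : z - zeta i != 0 by rewrite subr_eq0 h// mem_head.
rewrite !big_cons.
set Q := \prod_(_ <- r) _ in E1 E2 *; set s := \sum_(_ <- r) _ in E1 E2 *.
set s2 := \sum_(_ <- r) _ in E2 *.
rewrite !derivM derivXsubC mul1r derivD derivM derivXsubC mul1r !hornerE /= E1 E2.
by split; field.
Qed.

End log_derivative.

Section deriv_coef.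
Variables (S : comNzRingType) (Q : {poly S}) (n : nat).
Hypothesis sQ : (size Q <= n)%N.

Let QE : Q = \sum_(m < n) Q`_m *: 'X^m.
Proof.
rewrite -[LHS](coefK Q) poly_def (big_ord_widen n (fun m => Q`_m *: 'X^m))//.
rewrite big_mkcond; apply: eq_bigr => m _; case: ifPn => //.
by rewrite -leqNgt => /leq_sizeP/(_ _ (leqnn _)) ->; rewrite scale0r.
Qed.

(** The operator [z d/dz] multiplies the coefficient of degree [m] by [m]. Together with its
    second-order analogue, this turns derivatives at [z0] into factorial moments of the weights. *)
Lemma horner_deriv_sum z : z * Q^`().[z] = \sum_(m < n) Q`_m * z ^+ m *+ m.
Proof.
rewrite [in LHS]QE raddf_sum/= horner_sum mulr_sumr; apply: eq_bigr => m _.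
rewrite derivZ derivXn hornerZ hornerMn hornerXn -mulrnAr mulrCA; congr (_ * _).
by case: (nat_of_ord m) => [|k]; rewrite ?mulr0n ?mulr0// mulrnAr -exprS.
Qed.

Lemma horner_deriv2_sum z :
  z ^+ 2 * Q^`()^`().[z] = \sum_(m < n) Q`_m * z ^+ m *+ (m * m.-1).
Proof.
rewrite [in LHS]QE !raddf_sum/= horner_sum mulr_sumr; apply: eq_bigr => m _.
rewrite !derivZ derivXn derivMn derivXn hornerZ !hornerMn hornerXn.
rewrite -[RHS]mulrnAr mulrCA; congr (_ * _).
case: (nat_of_ord m) => [|[|k]]; rewrite ?muln0 ?mulr0n ?mulr0 ?mul0rn ?mulr0//.
by rewrite -mulrnA mulrnAr -exprD add2n mulnC.
Qed.

End deriv_coef.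

(** * Expansion of a Bernoulli factor on the unit circle *)

Section expi.
Context {R : realType}.
Implicit Types t s : R.

Definition expi t : R[i] := (cos t +i* sin t)%C.

Lemma expiD t s : expi (t + s) = expi t * expi s.
Proof.
by apply/eqP; rewrite eq_complex/= cosD sinD eqxx/= addrC [cos t * _]mulrC
  [sin t * cos s]mulrC [sin s * _]mulrC addrC eqxx.
Qed.

Lemma expiX t m : expi (m%:R * t) = expi t ^+ m.
Proof.
elim: m => [|m IH]; first by rewrite mul0r expr0 /expi cos0 sin0.
by rewrite -natr1 mulrDl mul1r expiD IH exprSr.
Qed.

Lemma normc_expi_sub1 t : 0 <= t -> normc (expi t - 1) <= t.
Proof.
move=> t0; rewrite /= subr0 -[leRHS]ger0_norm//.
rewrite -sqrtr_sqr ler_sqrt ?sqr_ge0//.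
have := cos2Dsin2 t; have := one_sub_cos_le t0; nra.
Qed.

(** The left side is [i (e^(it) - 1 - it)], the Taylor remainder after the linear term; its real
    part [t - sin t] and imaginary part [cos t - 1] are each at most [t ^+ 2 / 2] in absolute
    value. *)
Lemma normc_expi_taylor2 t : 0 <= t ->
  normc ('i%C * (expi t - 1) + t%:C%C) <= t ^+ 2.
Proof.
move=> t0; rewrite /= -[leRHS]ger0_norm ?sqr_ge0// -sqrtr_sqr.
rewrite ler_sqrt ?sqr_ge0//.
have := one_sub_cos_le t0; have := id_sub_sin_le t0; have := sin_le_id t0.
have := cos_le1 t; rewrite !(mul0r, mul1r, subr0, sub0r, addr0, add0r).
set c := cos t; set s := sin t => h1 h2 h3 h4.
have : (t - s) ^+ 2 <= (t ^+ 2 / 2) ^+ 2.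
  by rewrite ler_pXn2r ?nnegrE ?subr_ge0// (le_trans _ h3) ?subr_ge0.
have : (1 - c) ^+ 2 <= (t ^+ 2 / 2) ^+ 2.
  by rewrite ler_pXn2r ?nnegrE ?subr_ge0// (le_trans _ h4) ?subr_ge0.
have := sqr_ge0 (t ^+ 2); nra.
Qed.

Lemma normc_sum (I : Type) (r : seq I) (f : I -> R[i]) :
  normc (\sum_(i <- r) f i) <= \sum_(i <- r) normc (f i).
Proof.
elim: r => [|i r IH]; first by rewrite !big_nil normc0.
by rewrite !big_cons (le_trans (le_normcD _ _))// lerD2l.
Qed.

Lemma sqr_normc (a b : R) : normc (a +i* b)%C ^+ 2 = a ^+ 2 + b ^+ 2.
Proof. by rewrite /= sqr_sqrtr// addr_ge0 ?sqr_ge0. Qed.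

Lemma normc_ge0 (z : R[i]) : 0 <= normc z.
Proof. by case: z => a b; exact: sqrtr_ge0. Qed.

(* [i q e^(it) / (1 + q (e^(it) - 1))] is the logarithmic derivative of
   [1 + q (e^(it) - 1)], and [i q - q (1 - q) t] its expansion to first order. *)
Lemma bernoulli_cumulant_error (q : R[i]) (kappa t : R) :
  normc q <= kappa -> 0 <= t -> 2 * kappa * t <= 1 ->
  1 + q * (expi t - 1) != 0 /\
  normc ('i%C * (q * expi t / (1 + q * (expi t - 1)) - q) +
         q * (1 - q) * t%:C%C) <= 2 * kappa * (1 + kappa) ^+ 2 * t ^+ 2.
Proof.
move=> qk t0 kt1.
have k0 : 0 <= kappa by rewrite (le_trans _ qk)// normc_ge0.
have := normc_expi_sub1 t0; have := normc_expi_taylor2 t0.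
set u := expi t - 1 => h2 h1.
have -> : expi t = 1 + u by rewrite /u subrKC.
(* This is where [2 * kappa * t <= 1] enters: it keeps the denominator [1 + q * u] at distance at
   least [1 / 2] from [0]. *)
have qu : normc (q * u) <= 1 / 2.
  rewrite normcM (@le_trans _ _ (kappa * t))//; last lra.
  by rewrite ler_pM ?normc_ge0.
have hq : 1 / 2 <= normc (1 + q * u).
  have := le_normcD (1 + q * u) (- (q * u)).
  by rewrite addrK normcN normc1; lra.
have nz : 1 + q * u != 0.
  by apply/eqP => h; move: hq; rewrite h normc0; lra.
split=> //.
(* The error has the common factor [q * (1 - q)]. The four factors are bounded by [kappa],
   [1 + kappa], [(1 + kappa) * t ^+ 2] and [2], whose product is the stated constant. *)
have -> : 'i%C * (q * (1 + u) / (1 + q * u) - q) + q * (1 - q) * t%:C%C =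
  q * (1 - q) * ('i%C * u + t%:C%C + q * u * t%:C%C) * (1 + q * u)^-1.
  by field.
rewrite !normcM normcV.
have h3 : normc (1 - q) <= 1 + kappa.
  by have := le_normcD 1 (- q); rewrite normcN normc1; lra.
have h4 : normc ('i%C * u + t%:C%C + q * u * t%:C%C) <= (1 + kappa) * t ^+ 2.
  rewrite (le_trans (le_normcD _ _))// mulrDl mul1r lerD// !normcM.
  have -> : normc t%:C%C = t by rewrite /= expr0n/= addr0 sqrtr_sqr ger0_norm.
  by rewrite expr2 mulrA ler_pM ?mulr_ge0 ?normc_ge0// ler_pM ?normc_ge0.
have h5 : (normc (1 + q * u))^-1 <= 2.
  by rewrite invf_ple ?posrE; lra.
have -> : 2 * kappa * (1 + kappa) ^+ 2 * t ^+ 2 =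
  kappa * (1 + kappa) * ((1 + kappa) * t ^+ 2) * 2 by ring.
by rewrite !ler_pM ?mulr_ge0 ?normc_ge0 ?invr_ge0 ?normc_ge0.
Qed.

End expi.

Section tilted_weights.
Context {R : realType}.
Implicit Types (P : {poly R}) (z t : R) (N m : nat).

Definition weight P z m := P`_m * z ^+ m / P.[z].

Definition weight_mean N P z := \sum_(m < N.+1) weight P z m * m%:R.

Definition weight_var N P z :=
  \sum_(m < N.+1) weight P z m * (m%:R - weight_mean N P z) ^+ 2.

(** With [sin_part], the real and imaginary parts of the characteristic function of the centred
    weights; keeping them apart means that only real functions are differentiated. *)
Definition cos_part N P z t :=
  \sum_(m < N.+1) weight P z m * cos ((m%:R - weight_mean N P z) * t).

Definition sin_part N P z t :=
  \sum_(m < N.+1) weight P z m * sin ((m%:R - weight_mean N P z) * t).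

End tilted_weights.

(** * Moments and characteristic function in terms of the zeros *)

Section zeros_away.
Variables (R : realType) (delta z0 : R) (N : nat) (P : {poly R}).
Variable zeta : 'I_N -> R[i].
Hypotheses (delta0 : 0 < delta) (z00 : 0 < z0).
Hypotheses (sP : size P = N.+1) (PN : 0 < P`_N).
Hypothesis Pzeta : complex_roots P zeta.
Hypothesis zetaP : forall j, (delta%:C)%C <= `|(z0%:C)%C - zeta j|.

Local Notation "x %:C" := (real_complex R x) : ring_scope.
Local Notation kappa := (z0 / delta).
Local Notation p := (weight P z0).
Local Notation mu := (weight_mean N P z0).
Local Notation v := (weight_var N P z0).
Local Notation A := (cos_part N P z0).
Local Notation B := (sin_part N P z0).
Let Pc := map_poly (real_complex R) P.
Let q j : R[i] := z0%:C / (z0%:C - zeta j).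
Let kappa0 : 0 < kappa. Proof. exact: divr_gt0. Qed.

Let K0 : 0 <= 2 * kappa * (1 + kappa) ^+ 2 * N%:R.
Proof. by rewrite mulr_ge0// mulr_ge0 ?sqr_ge0// mulr_ge0// ltW. Qed.

Let normc_zeta j : delta <= normc (z0%:C - zeta j).
Proof.
have := zetaP j; rewrite normc_def lecR; congr (_ <= _).
by case: (z0%:C - zeta j).
Qed.

Let z0zeta j : z0%:C - zeta j != 0.
Proof.
apply/eqP => h; have := normc_zeta j; rewrite h normc0.
by move/(lt_le_trans delta0); rewrite ltxx.
Qed.

Let normc_real (x : R) : 0 <= x -> normc x%:C = x.
Proof. by move=> x0; rewrite /= expr0n/= addr0 sqrtr_sqr ger0_norm. Qed.

Let normc_q j : normc (q j) <= kappa.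
Proof.
rewrite /q normcM normcV normc_real; last exact: ltW.
by rewrite ler_pM2l// lef_pV2 ?posrE// (lt_le_trans delta0).
Qed.

Let Pc_sum z : Pc.[z] = \sum_(m < N.+1) (P`_m)%:C * z ^+ m.
Proof.
rewrite (@horner_coef_wide _ N.+1) ?size_map_poly ?sP//.
by apply: eq_bigr => m _; rewrite coef_map.
Qed.

Let Pc_real x : Pc.[x%:C] = (P.[x])%:C.
Proof. by rewrite horner_map. Qed.

Let Pc_prod : Pc = (P`_N)%:C *: \prod_(j < N) ('X - (zeta j)%:P).
Proof. by rewrite /Pc Pzeta lead_coefE sP. Qed.

Let Pc_deriv z : (forall j, z != zeta j) ->
  Pc^`().[z] = Pc.[z] * \sum_j (z - zeta j)^-1 /\
  Pc^`()^`().[z] = Pc.[z] *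
    ((\sum_j (z - zeta j)^-1) ^+ 2 - \sum_j (z - zeta j) ^- 2).
Proof.
move=> h; have [|E1 E2] := @horner_deriv_prod_XsubC _ _ zeta (index_enum _) z.
  by move=> j _.
by rewrite Pc_prod !derivZ !hornerZ E1 E2 !mulrA.
Qed.

Let Pz0 : P.[z0] != 0.
Proof.
apply/eqP => h; have := Pc_real z0; rewrite h Pc_prod hornerZ horner_prod => /eqP.
rewrite mulf_eq0 => /orP[/eqP[] E|].
  by move: PN; rewrite E ltxx.
rewrite prodf_seq_eq0 => /hasP[j _ /=]; rewrite hornerXsubC => /eqP h'.
by have := z0zeta j; rewrite h' eqxx.
Qed.

Let Pz0C : (P.[z0])%:C != 0 :> R[i].
Proof. by rewrite fmorph_eq0. Qed.

Let pC m : (p m)%:C = (P`_m)%:C * z0%:C ^+ m / (P.[z0])%:C.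
Proof. by rewrite /weight rmorphM fmorphV rmorphM rmorphXn. Qed.

Lemma sum_weight : \sum_(m < N.+1) p m = 1.
Proof.
by rewrite /weight -mulr_suml -horner_coef_wide ?sP// divff.
Qed.

Let z0_neq j : z0%:C != zeta j. Proof. by rewrite -subr_eq0. Qed.

Let sPc : (size Pc <= N.+1)%N. Proof. by rewrite size_map_poly sP. Qed.

(** Both sides are [z0 P'(z0) / P(z0)], computed once from the coefficients and once from the
    factorisation. *)
Lemma mean_roots : mu%:C = \sum_j q j.
Proof.
have [E _] := Pc_deriv z0_neq.
rewrite /weight_mean rmorph_sum/= -mulr_sumr.
apply: (mulfI Pz0C); rewrite mulrCA -Pc_real -E Pc_real.
rewrite (horner_deriv_sum sPc) mulr_sumr; apply: eq_bigr => m _.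
rewrite rmorphM/= pC rmorph_nat coef_map/= -mulr_natr; field.
by rewrite Pz0C.
Qed.

(** The second factorial moment is [z0^2 P''(z0) / P(z0)]. Passing to the variance adds the mean and
    subtracts its square, which cancels the squared logarithmic derivative and leaves a sum over
    single roots. *)
Lemma variance_roots : v%:C = \sum_j q j * (1 - q j).
Proof.
have [E1 E2] := Pc_deriv z0_neq.
have m2 : \sum_(m < N.+1) (p m)%:C * (m%:R * (m%:R - 1)) =
    z0%:C ^+ 2 * ((\sum_j (z0%:C - zeta j)^-1) ^+ 2 -
                  \sum_j (z0%:C - zeta j) ^- 2).
  apply: (mulfI Pz0C); rewrite [RHS]mulrCA -Pc_real -E2 Pc_real.
  rewrite (horner_deriv2_sum sPc) mulr_sumr; apply: eq_bigr => m _.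
  rewrite pC coef_map/= -[RHS]mulr_natr.
  have -> : (m * m.-1)%:R = m%:R * (m%:R - 1) :> R[i].
    by case: (nat_of_ord m) => [|k]; rewrite ?mul0r// natrM/= -[X in _ = _ * (X - 1)]natr1 addrK.
  by field; rewrite Pz0C.
have vE : v%:C = \sum_(m < N.+1) (p m)%:C * (m%:R * (m%:R - 1)) + mu%:C - mu%:C ^+ 2.
  have -> : v = \sum_(m < N.+1) p m * (m%:R * (m%:R - 1)) + mu - mu ^+ 2.
    have h c : \sum_(m < N.+1) p m * (m%:R - c) ^+ 2 =
      \sum_(m < N.+1) p m * (m%:R * (m%:R - 1)) +
      \sum_(m < N.+1) p m * m%:R - 2 * c * (\sum_(m < N.+1) p m * m%:R)
      + c ^+ 2 * \sum_(m < N.+1) p m.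
      rewrite !mulr_sumr -!sumrN -!big_split/=; apply: eq_bigr => m _; ring.
    by rewrite /weight_var h sum_weight -/(weight_mean N P z0); ring.
  rewrite !(rmorphD, rmorphN, rmorphXn, rmorph_sum)/=; congr (_ + _ - _).
  by apply: eq_bigr => m _; rewrite !(rmorphM, rmorphB, rmorph_nat, rmorph1).
rewrite vE m2 mean_roots /q -mulr_sumr.
rewrite [RHS](_ : _ = z0%:C * \sum_j (z0%:C - zeta j)^-1 -
    z0%:C ^+ 2 * \sum_j (z0%:C - zeta j) ^- 2); first by ring.
by rewrite !mulr_sumr -sumrB; apply: eq_bigr => j _; field.
Qed.

(** At most linear growth of the variance in [N] later ensures that the rescaled argument
    [t / sigma] stays where the cumulant expansion holds. *)
Lemma variance_le : v <= N%:R * (kappa * (1 + kappa)).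
Proof.
have v0 : normc v%:C = `|v| by rewrite /= expr0n/= addr0 sqrtr_sqr.
apply: (le_trans (ler_norm _)); rewrite -v0 variance_roots.
apply: (le_trans (normc_sum _ _)).
rewrite -[in leRHS](card_ord N) mulr_natl -sumr_const; apply: ler_sum => j _.
rewrite normcM ler_pM ?normc_ge0//.
have := le_normcD 1 (- q j); rewrite normcN normc1 => /le_trans; apply.
by rewrite lerD2l.
Qed.

Let dA t :=
  \sum_(m < N.+1) p m * (- sin ((m%:R - mu) * t) * (m%:R - mu)).
Let dB t :=
  \sum_(m < N.+1) p m * (cos ((m%:R - mu) * t) * (m%:R - mu)).

Let is_derive_cos_part (x : R) : is_derive x 1 A (dA x).
Proof.
apply: is_derive_bigsum => m; derive_eq; first solve_derive.
by cbv beta; ring.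
Qed.

Let is_derive_sin_part (x : R) : is_derive x 1 B (dB x).
Proof.
apply: is_derive_bigsum => m; derive_eq; first solve_derive.
by cbv beta; ring.
Qed.

Let complex_sum n (f g : 'I_n -> R) :
  ((\sum_(m < n) f m) +i* (\sum_(m < n) g m))%C =
  \sum_(m < n) (f m +i* g m)%C.
Proof.
elim: n f g => [|n IH] f g; first by rewrite !big_ord0.
by rewrite !big_ord_recr/= -IH.
Qed.

(** The centred characteristic function is [e^(-i mu t) P(z0 e^(it)) / P(z0)]; [dchiE] gives its
    derivative in the same terms. *)
Let chiE t : (A t +i* B t)%C =
  expi (- mu * t) * Pc.[z0%:C * expi t] / (P.[z0])%:C.
Proof.
rewrite /cos_part /sin_part complex_sum Pc_sum mulr_sumr mulr_suml; apply: eq_bigr => m _.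
transitivity ((p m)%:C * expi ((m%:R - mu) * t)).
  by apply/eqP; rewrite eq_complex/= !mul0r subr0 addr0 !eqxx.
rewrite mulrDl addrC expiD expiX pC exprMn; ring.
Qed.

Let dchiE t : (dA t +i* dB t)%C =
  'i%C * expi (- mu * t) * (z0%:C * expi t * Pc^`().[z0%:C * expi t] -
    mu%:C * Pc.[z0%:C * expi t]) / (P.[z0])%:C.
Proof.
rewrite /cos_part /sin_part complex_sum Pc_sum (horner_deriv_sum sPc) [mu%:C * _]mulr_sumr -sumrB.
rewrite mulr_sumr mulr_suml; apply: eq_bigr => m _.
transitivity ('i%C * (p m)%:C * (m%:R - mu)%:C * expi ((m%:R - mu) * t)).
  by apply/eqP; rewrite eq_complex/=; apply/andP; split; apply/eqP; ring.
rewrite (rmorphB (real_complex R)) rmorph_nat mulrDl addrC expiD expiX pC exprMn.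
by rewrite coef_map/= -[_ *+ m]mulr_natr; ring.
Qed.

(** The logarithmic derivative of [chi] splits over the roots, each contributing [i (q_j e^(it) / (1
    + q_j (e^(it) - 1)) - q_j)]. Adding [v t] pairs each contribution with its linear term, so that
    [chi' + v t chi = rho chi] and [rho] is a sum of [N] errors controlled by
    [bernoulli_cumulant_error]. *)
Let char_ode t : 0 <= t <= (2 * kappa)^-1 ->
  (dA t + v * t * A t) ^+ 2 +
  (dB t + v * t * B t) ^+ 2 <=
  (2 * kappa * (1 + kappa) ^+ 2 * N%:R * t ^+ 2) ^+ 2 *
  (A t ^+ 2 + B t ^+ 2).
Proof.
move=> /andP[t0 tk].
have kt : 2 * kappa * t <= 1.
  have k2 : 0 < 2 * kappa by rewrite mulr_gt0.
  by rewrite -[leRHS](mulfV (lt0r_neq0 k2)) ler_pM2l.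
have berr j := bernoulli_cumulant_error (normc_q j) t0 kt.
pose rho := \sum_j ('i%C * (q j * expi t / (1 + q j * (expi t - 1)) - q j) +
         q j * (1 - q j) * t%:C).
have rho_le : normc rho <= 2 * kappa * (1 + kappa) ^+ 2 * N%:R * t ^+ 2.
  apply: (le_trans (normc_sum _ _)); rewrite mulrAC.
  rewrite -[in leRHS](card_ord N) mulr_natr -sumr_const.
  by apply: ler_sum => j _; have [] := berr j.
(* The factor [1 + q j * (expi t - 1)] is nonzero, so this also shows that [z0 e^(it)] is not a root
   and that the logarithmic derivative makes sense there. *)
have fac j : z0%:C * expi t - zeta j =
    (z0%:C - zeta j) * (1 + q j * (expi t - 1)).
  by rewrite /q; field.
have zneq j : z0%:C * expi t != zeta j.
  by rewrite -subr_eq0 fac mulf_neq0//; have [] := berr j.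
have [E _] := Pc_deriv zneq.
have ->: (dA t + v * t * A t) ^+ 2 +
    (dB t + v * t * B t) ^+ 2 =
    normc rho ^+ 2 * (A t ^+ 2 + B t ^+ 2).
  rewrite -!sqr_normc -exprMn -normcM; congr (normc _ ^+ 2).
  transitivity ((dA t +i* dB t)%C +
      v%:C * t%:C * (A t +i* B t)%C).
    by apply/eqP; rewrite eq_complex/=; apply/andP; split; apply/eqP; ring.
  have -> : rho = 'i%C * (z0%:C * expi t * \sum_j (z0%:C * expi t - zeta j)^-1 -
      \sum_j q j) + (\sum_j q j * (1 - q j)) * t%:C.
    rewrite mulr_sumr -sumrB mulr_sumr mulr_suml -big_split/=.
    apply: eq_bigr => j _; rewrite fac; have [+ _] := berr j.
    move: (1 + q j * (expi t - 1)) => w w0; congr ('i%C * (_ - _) + _).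
    by rewrite /q; field; rewrite w0 z0zeta.
  by rewrite dchiE E chiE variance_roots mean_roots; ring.
rewrite ler_wpM2r ?addr_ge0 ?sqr_ge0// ler_pXn2r ?nnegrE ?normc_ge0//.
by rewrite mulr_ge0 ?sqr_ge0 ?K0.
Qed.

Lemma char_dist a b t : 0 <= t <= (2 * kappa)^-1 -> a ^+ 2 + b ^+ 2 = 1 ->
  `|a * A t + b * B t - a * expR (- (v * t ^+ 2 / 2))| <=
  expR (- (v * t ^+ 2 / 2)) *
  (expR (2 * kappa * (1 + kappa) ^+ 2 * N%:R * t ^+ 3 / 3) - 1).
Proof.
move=> tk ab; apply: (gaussian_ode_dist K0 is_derive_cos_part is_derive_sin_part _ _ char_ode) => //.
- rewrite -[RHS]sum_weight; apply: eq_bigr => m _.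
  by rewrite mulr0 cos0 mulr1.
- by apply: big1 => m _; rewrite mulr0 sin0 mulr0.
Qed.

End zeros_away.

(** * The Fourier transform of the Gaussian *)

Section gaussian_fourier.
Context {R : realType}.
Implicit Types (x t : R).
Local Notation mu := (@lebesgue_measure R).

(** Left unnormalised; the factor [Num.sqrt (2 * pi)] is carried explicitly wherever probabilities
    are meant. *)
Definition gauss x : R := expR (- x ^+ 2 / 2).

Lemma gauss_ge0 x : 0 <= gauss x. Proof. exact: expR_ge0. Qed.

Lemma is_derive_gauss x : is_derive x 1 gauss (- x * gauss x).
Proof.
rewrite (_ : gauss = fun y => expR (- (y * y) / 2)).
  derive_eq; first solve_derive.
  by rewrite /gauss; cbv beta; field.
by apply/funext => y; rewrite /gauss expr2.
Qed.

Lemma continuous_gauss : continuous gauss.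
Proof. exact: is_derive_continuous is_derive_gauss. Qed.

Lemma normal_pdf01 x : normal_pdf 0 1 x = (Num.sqrt (2 * pi))^-1 * gauss x.
Proof.
rewrite normal_pdfE ?oner_eq0// /normal_peak /normal_fun expr1n mul1r subr0.
by rewrite mulr_natl.
Qed.

(** Up to a constant this is the normal density of variance [c / 2]. *)
Lemma integrable_expR_sqr (c : R) : 0 < c ->
  mu.-integrable setT (EFin \o fun x => expR (- x ^+ 2 / c)).
Proof.
move=> c0; pose s := Num.sqrt (c / 2).
have s0 : s != 0 by rewrite gt_eqF// sqrtr_gt0 divr_gt0.
have s2 : s ^+ 2 *+ 2 = c.
  by rewrite /s sqr_sqrtr ?divr_ge0 ?ltW// -mulr_natr divfK.
have p0 : 0 < normal_peak s by rewrite normal_peak_gt0.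
rewrite [X in _.-integrable _ X](_ : _ =
  fun x => ((normal_peak s)^-1%:E * (normal_pdf 0 s x)%:E)%E).
  exact/integrableZl/integrable_normal_pdf.
apply/funext => x /=; rewrite -EFinM normal_pdfE// mulrA mulVf ?gt_eqF// mul1r.
by rewrite /normal_fun s2 subr0.
Qed.

Lemma sqrt2pi_gt0 : 0 < Num.sqrt (2 * pi) :> R.
Proof. by rewrite sqrtr_gt0 mulr_gt0// pi_gt0. Qed.

Lemma Rintegral_gauss : \int[mu]_x gauss x = Num.sqrt (2 * pi).
Proof.
have := integral_normal_pdf (0 : R) 1.
under eq_integral do rewrite normal_pdf01 EFinM.
rewrite integralZl//=; last exact: integrable_expR_sqr.
have /(integrable_fin_num measurableT) : mu.-integrable setT (EFin \o gauss).
  exact: integrable_expR_sqr.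
rewrite /Rintegral; case: (\int[_]_(_ in _) _)%E => //= r _ [] h.
apply: (mulfI (invr_neq0 (lt0r_neq0 sqrt2pi_gt0))).
by rewrite h mulVf// gt_eqF// sqrt2pi_gt0.
Qed.

(** Half of the exponent absorbs the linear factor, since [|x| <= 1 + x^2 / 4 <= exp (x^2 / 4)]. The
    right side is the dominating function for differentiation under the integral. *)
Lemma abs_gauss_le x : `|x| * gauss x <= expR (- x ^+ 2 / 4).
Proof.
have -> : expR (- x ^+ 2 / 4) = expR (x ^+ 2 / 4) * gauss x.
  by rewrite /gauss -expRD; congr expR; field.
rewrite ler_wpM2r ?gauss_ge0//.
have := expR_ge1Dx (x ^+ 2 / 4); apply: le_trans.
by rewrite -[x ^+ 2]real_normK ?num_real//; have := sqr_ge0 (`|x| / 2 - 1); lra.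
Qed.

Lemma gauss_nat_le (n : nat) : gauss n%:R <= 2 * harmonic n.
Proof.
have -> : 2 * harmonic n = (n.+1%:R / 2)^-1 :> R by rewrite /harmonic/= invf_div.
rewrite /gauss mulNr expRN lef_pV2 ?posrE ?expR_gt0 ?divr_gt0//.
apply: le_trans (expR_ge1Dx _).
by rewrite -natr1; have := sqr_ge0 (n%:R - 1 : R); have := ler0n R n; lra.
Qed.

(** Integration by parts in disguise: on [[-n, n]] the integral is [H n - H (- n)], which tends to
    [0] by the Gaussian bound, while dominated convergence sends it to the integral over the
    line. *)
Lemma Rintegral_derive_eq0 (H h : R -> R) :
  (forall x, is_derive x 1 H (h x)) -> continuous h ->
  mu.-integrable setT (EFin \o h) -> (forall x, `|H x| <= gauss x) ->
  \int[mu]_x h x = 0.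
Proof.
move=> dH ch ih Hg.
pose D (n : nat) : set R := `[- n%:R, n%:R]%classic.
have mh := measurable_int mu ih.
have [] := @dominated_convergence _ _ _ mu setT measurableT
  (fun n => (EFin \o h) \_ (D n)) (EFin \o h) (fun x => `|(h x)%:E|%E).
- move=> n; have ihD : mu.-integrable (D n) (EFin \o h).
    by apply: integrableS ih => //; exact: measurable_itv.
  apply: (measurable_int mu).
  apply: (@integrable_mkcond _ _ _ mu (D n) (EFin \o h) _).1 => //.
  exact: measurable_itv.
- exact: mh.
- apply: aeW => x _; apply: cvg_near_cst.
  exists (Num.truncn `|x|).+1 => // n /= xn.
  rewrite patchE ifT// inE /D/= in_itv/= -ler_norml.
  apply/ltW/(lt_le_trans (truncnS_gt _)); by rewrite ler_nat.
- exact: integrable_abse.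
- apply: aeW => x n _; rewrite patchE; case: ifP => // _.
  by rewrite abse0.
move=> _ _.
rewrite -[X in _ --> X](fineK (integrable_fin_num measurableT ih)) => /fine_cvg.
have h0 : (fun n => fine (\int[mu]_x ((EFin \o h) \_ (D n)) x)%E) @ \oo --> (0 : R).
  have c4 : (fun n => 4 * harmonic n : R) @ \oo --> (0 : R).
    by rewrite -[X in _ --> X](mulr0 4); apply: cvgMr => //; exact: cvg_harmonic.
  apply: norm_cvg0; apply: (squeeze_cvgr _ (cvg_cst 0) c4).
  near=> n; rewrite normr_ge0/= -integral_mkcond.
  have n0 : - n%:R < n%:R :> R.
    by rewrite -subr_gt0 opprK -mulr2n pmulrn_lgt0// ltr0n; near: n; exists 1%N.
  rewrite (continuous_FTC2 (F := H) n0).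
  - rewrite -EFinB/= (le_trans (ler_normB _ _))//.
    have -> : 4 * harmonic n = 2 * harmonic n + 2 * harmonic n :> R by ring.
    apply: lerD; apply: le_trans (Hg _) _; last first.
      by rewrite /gauss sqrrN; exact: gauss_nat_le.
    exact: gauss_nat_le.
  - exact: continuous_subspaceT.
  - have cH := is_derive_continuous dH; split.
    + by move=> x _; have [] := dH x.
    + by apply: cvg_at_right_filter; exact: cH.
    + by apply: cvg_at_left_filter; exact: cH.
  - by move=> x _; rewrite derive1E; have [] := dH x.
by move=> h1; exact: (cvg_unique _ h1 h0).
Unshelve. all: end_near. Qed.

Variable b : R.

Let fcos t : R := \int[mu]_x (cos (t * x + b) * gauss x).

Let integrable_le (f : R -> R) (c : R) : 0 < c -> continuous f ->
  (forall x, `|f x| <= expR (- x ^+ 2 / c)) -> mu.-integrable setT (EFin \o f).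
Proof.
move=> c0 cf fc; apply: (le_integrable _ _ _ (integrable_expR_sqr c0)) => //.
  by apply/measurable_EFinP; exact: continuous_measurable_fun.
by move=> x _; rewrite lee_fin [leRHS]ger0_norm ?expR_ge0.
Qed.

Let le_gauss (c x : R) : `|c| <= 1 -> `|c * gauss x| <= gauss x.
Proof.
by move=> c1; rewrite normrM [`|gauss x|]ger0_norm ?gauss_ge0// ler_piMl ?gauss_ge0.
Qed.

Let continuous_cosg t : continuous (fun x => cos (t * x + b) * gauss x).
Proof.
pose dg := is_derive_gauss.
by apply: is_derive_continuous => x; solve_derive.
Qed.

Lemma integrable_cos_gauss t :
  mu.-integrable setT (EFin \o fun x => cos (t * x + b) * gauss x).
Proof.
by apply: (@integrable_le _ 2) => // x; apply: le_gauss; exact: cos_max.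
Qed.

Let integrable_xsin t :
  mu.-integrable setT (EFin \o fun x => x * sin (t * x + b) * gauss x).
Proof.
pose dg := is_derive_gauss.
apply: (@integrable_le _ 4) => //.
  by apply: is_derive_continuous => x; solve_derive.
move=> x; apply: le_trans (abs_gauss_le x); rewrite !normrM.
rewrite [`|gauss x|]ger0_norm ?gauss_ge0// ler_wpM2r ?gauss_ge0//.
by rewrite ler_piMr// sin_max.
Qed.

(** Differentiation under the integral gives the integral of [- x sin (t x + b) gauss x]; adding
    [t * fcos t] makes the integrand the [x]-derivative of [sin (t x + b) gauss x], whose integral
    vanishes. *)
Let fcos_derive t : is_derive t 1 fcos (- (t * fcos t)).
Proof.
pose dg := is_derive_gauss.
pose f (s x : R) := cos (s * x + b) * gauss x.
have df (s x : R) : is_derive s 1 (f ^~ x) (- (x * sin (s * x + b) * gauss x)).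
  by derive_eq; [rewrite /f; solve_derive|cbv beta; ring].
have d1 s x : partial1of2 f s x = - (x * sin (s * x + b) * gauss x).
  by rewrite partial1of2E; have [] := df s x.
have tI : `]t - 1, t + 1[%classic t by rewrite /= in_itv/=; apply/andP; split; lra.
have h1 (s : R) : `]t - 1, t + 1[%classic s -> mu.-integrable setT (EFin \o f s).
  by move=> _; exact: integrable_cos_gauss.
have h2 (s x : R) : `]t - 1, t + 1[%classic s -> setT x -> derivable (f ^~ x) s 1.
  by move=> _ _; have [] := df s x.
have h3 (s x : R) : `]t - 1, t + 1[%classic s -> setT x ->
    `|partial1of2 f s x| <= expR (- x ^+ 2 / 4).
  move=> _ _; rewrite d1 normrN; apply: le_trans (abs_gauss_le x); rewrite !normrM.
  rewrite [`|gauss x|]ger0_norm ?gauss_ge0// ler_wpM2r ?gauss_ge0//.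
  by rewrite ler_piMr// sin_max.
have i4 : mu.-integrable setT (EFin \o fun x => expR (- x ^+ 2 / 4)).
  exact: integrable_expR_sqr.
apply: DeriveDef.
  exact: (derivable_under_integral measurableT tI h1 h2 (fun x => expR_ge0 _) i4 h3).
rewrite -derive1E.
rewrite (differentiation_under_integral measurableT tI h1 h2 (fun x => expR_ge0 _) i4 h3).
apply/eqP; rewrite -subr_eq0 opprK /fcos -RintegralZl//; last exact: integrable_cos_gauss.
rewrite -RintegralD//.
- apply/eqP; apply: (@Rintegral_derive_eq0 (fun x => sin (t * x + b) * gauss x)).
  + move=> x; derive_eq; first solve_derive.
    by rewrite d1; cbv beta; ring.
  (* The witness is the derivative of the integrand, written out only to obtain continuity. *)
  + apply: (@is_derive_continuous _ _ (fun x => - (sin (t * x + b) * gauss x +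
      x * (t * cos (t * x + b) * gauss x) - x * x * sin (t * x + b) * gauss x)
      + t * (- t * sin (t * x + b) * gauss x - x * cos (t * x + b) * gauss x))) => x.
    rewrite (_ : (fun _ => _) = fun y => - (y * sin (t * y + b) * gauss y) +
      t * (cos (t * y + b) * gauss y)); last by apply/funext => y; rewrite d1.
    by derive_eq; [solve_derive|cbv beta; ring].
  + rewrite (_ : _ \o _ = fun x => (- (x * sin (t * x + b) * gauss x)%:E +
      (t * (cos (t * x + b) * gauss x))%:E)%E); last first.
      by apply/funext => y /=; rewrite d1.
    apply: integrableD => //.
      by apply: integrableN; exact: integrable_xsin.
    by under eq_fun do rewrite EFinM; apply: integrableZl => //; exact: integrable_cos_gauss.
  + by move=> x; apply: le_gauss; exact: sin_max.
- rewrite (_ : _ \o _ = fun x => (- (x * sin (t * x + b) * gauss x)%:E)%E); last first.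
    by apply/funext => y /=; rewrite d1.
  by apply: integrableN; exact: integrable_xsin.
- rewrite (_ : _ \o _ = fun x => (t%:E * (cos (t * x + b) * gauss x)%:E)%E)//.
  by apply: integrableZl => //; exact: integrable_cos_gauss.
Qed.

(** By [fcos_derive], [fcos t * exp (t^2 / 2)] is constant. The phase [b] allows for a translation
    of the Gaussian variable, with [b = - (t * a)]. *)
Lemma Rintegral_cos_gauss t :
  \int[mu]_x (cos (t * x + b) * gauss x) = cos b * Num.sqrt (2 * pi) * gauss t.
Proof.
have : fcos t * expR (t * t / 2) = fcos 0 * expR (0 * 0 / 2).
  apply: (@is_derive_0_is_cst _ (fun s => fcos s * expR (s * s / 2))) => x.
  pose dg := fcos_derive.
  by derive_eq; [solve_derive|cbv beta; field].
rewrite !mul0r expR0 mulr1.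
have -> : fcos 0 = cos b * Num.sqrt (2 * pi).
  rewrite -Rintegral_gauss -RintegralZl//; last exact: integrable_expR_sqr.
  by apply: eq_Rintegral => x _; rewrite mul0r add0r.
move=> <-; rewrite -[RHS]mulrA -[gauss t]/(expR _) -expRD.
have -> : t * t / 2 + - t ^+ 2 / 2 = 0 by field.
by rewrite expR0 mulr1.
Qed.

End gaussian_fourier.

(** * The Fourier representation of the absolute value *)

Section inverse_square_kernel.
Context {R : realType}.
Implicit Types (x y t T : R).
Local Notation mu := (@lebesgue_measure R).

(* The weight of the representation [c |y| = int (1 - cos (t y)) / t^2 dt]. *)
Definition invsq t : R := \1_(`]0, +oo[%classic) t * (t ^+ 2)^-1.

Lemma invsqE t : 0 < t -> invsq t = (t ^+ 2)^-1.
Proof. by move=> t0; rewrite /invsq indicE mem_set ?mul1r//= in_itv/= t0. Qed.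

Lemma invsq0 t : t <= 0 -> invsq t = 0.
Proof.
move=> t0; rewrite /invsq indicE memNset ?mul0r//=.
by rewrite in_itv/= andbT; apply/negP; rewrite -leNgt.
Qed.

Lemma invsq_ge0 t : 0 <= invsq t.
Proof. by rewrite mulr_ge0// invr_ge0 sqr_ge0. Qed.

Lemma measurable_sqrV : measurable_fun [set: R] (fun t : R => (t ^+ 2)^-1).
Proof.
rewrite (_ : (fun _ => _) = fun t : R => (`|t| `^ (-1)) ^+ 2).
  by apply: measurable_funX; apply: (measurableT_comp (measurable_powR _)).
by apply/funext => t; rewrite powR_inv1// exprVn real_normK ?num_real.
Qed.

Lemma measurable_invsq : measurable_fun [set: R] invsq.
Proof.
apply: measurable_funM measurable_sqrV.
by apply: measurable_indic; exact: measurable_itv.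
Qed.

Lemma integral_invsq (f : R -> R) :
  (\int[mu]_t (f t * invsq t)%:E = \int[mu]_(t in `]0%R, +oo[) (f t * invsq t)%:E)%E.
Proof.
rewrite [RHS]integral_mkcond; apply: eq_integral => t _; rewrite patchE.
case: ifPn => //; rewrite notin_setE/= in_itv/= andbT => /negP.
by rewrite -leNgt => /invsq0 ->; rewrite mulr0.
Qed.

Lemma integral_invsq_tail T : 0 < T ->
  (\int[mu]_(t in `[T, +oo[) (t ^+ 2)^-1%:E = T^-1%:E)%E.
Proof.
move=> T0.
have dF (x : R) : 0 < x -> is_derive x 1 (fun y => - y^-1) (x ^+ 2)^-1.
  move=> x0; have h : is_derive x 1 (fun y : R => y^-1) (- x ^- 2 *: 1).
    by apply: (@is_deriveV _ id); rewrite ?gt_eqF.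
  by derive_eq; [notypeclasses refine (is_derive_opp h)|rewrite scaler1 opprK].
have cF (x : R) : 0 < x -> {for x, continuous (fun y : R => (y ^+ 2)^-1)}.
  move=> x0; apply: cvgV; first by rewrite sqrf_eq0 gt_eqF.
  exact: sqr_continuous.
rewrite (@ge0_continuous_FTC2y _ _ (fun y => - y^-1) _ 0).
- by rewrite -EFinB sub0r opprK.
- by move=> x _; rewrite invr_ge0 sqr_ge0.
- apply/continuous_within_itvcyP; split.
    by move=> x; rewrite in_itv/= andbT => Tx; apply: cF; exact: lt_trans Tx.
  by apply: cvg_at_right_filter; exact: cF.
- rewrite -oppr0; apply: cvgN; apply/gtr0_cvgV0; last exact: cvg_id.
  exact: nbhs_pinfty_gt.
- by move=> x Tx; have [] := dF x (lt_trans T0 Tx).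
- apply: cvg_at_right_filter.
  by have [+ _] := dF T T0 => /derivable1_diffP/differentiable_continuous.
- move=> x; rewrite in_itv/= andbT => Tx; rewrite derive1E.
  by have [_ ->] := dF x (lt_trans T0 Tx).
Unshelve. all: end_near. Qed.

Lemma ge0_integral_split (f : R -> \bar R) T : 0 < T ->
  measurable_fun [set: R] f -> (forall t, (0 <= f t)%E) ->
  (\int[mu]_(t in `]0%R, +oo[) f t =
   \int[mu]_(t in `]0%R, T]) f t + \int[mu]_(t in `]T, +oo[) f t)%E.
Proof.
move=> T0 mf f0; rewrite (@itv_bndbnd_setU _ _ _ (BRight T)) ?bnd_simp ?ltW//.
rewrite ge0_integral_setU//.
  exact: measurable_funTS.
apply/disj_setPS => t [] /=; rewrite !in_itv/= andbT => /andP[_ tT] Tt.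
by move: (le_lt_trans tT Tt); rewrite ltxx.
Qed.

Lemma integral_id_gauss T : 0 < T ->
  (\int[mu]_(t in `]0%R, T]) (t * expR (- t ^+ 2 / 4))%:E <= 2%:E)%E.
Proof.
move=> T0.
have dF (x : R) : is_derive x 1 (fun y => - 2 * expR (- (y * y) / 4))
    (x * expR (- x ^+ 2 / 4)).
  derive_eq; first solve_derive.
  by cbv beta; rewrite [x ^+ 2]expr2; field.
have df (x : R) : is_derive x 1 (fun y => y * expR (- y ^+ 2 / 4))
    (expR (- x ^+ 2 / 4) + x * (expR (- x ^+ 2 / 4) * (- (x / 2)))).
  rewrite (_ : (fun _ => _) = fun y => y * expR (- (y * y) / 4)); last first.
    by apply/funext => y; rewrite expr2.
  by derive_eq; [solve_derive|cbv beta; rewrite expr2; field].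
have cf := is_derive_continuous df.
rewrite integral_itv_obnd_cbnd; last first.
  by apply: measurable_funTS; apply/measurable_EFinP; exact: continuous_measurable_fun.
rewrite (continuous_FTC2 (F := fun y => - 2 * expR (- (y * y) / 4)) T0).
- rewrite -EFinB lee_fin mul0r oppr0 mul0r expR0.
  by have := expR_ge0 (- (T * T) / 4); lra.
- exact: continuous_subspaceT.
- have cF := is_derive_continuous dF; split.
  + by move=> x _; have [] := dF x.
  + by apply: cvg_at_right_filter; exact: cF.
  + by apply: cvg_at_left_filter; exact: cF.
- by move=> x _; rewrite derive1E; have [] := dF x.
Qed.

(** Beyond [T] only [E t <= 2] is used, and the integral of [1 / t^2] there is [1 / T]. *)
Lemma integral_invsq_le_head (E : R -> R) T : 0 < T ->
  measurable_fun [set: R] E -> (forall t, 0 <= E t <= 2) ->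
  (\int[mu]_t (E t * invsq t)%:E <=
   \int[mu]_(t in `]0%R, T]) (E t * invsq t)%:E + (2 / T)%:E)%E.
Proof.
move=> T0 mE E0.
have mEi : measurable_fun [set: R] (fun t => (E t * invsq t)%:E).
  by apply/measurable_EFinP/measurable_funM => //; exact: measurable_invsq.
have Ei0 t : (0 <= (E t * invsq t)%:E)%E.
  by rewrite lee_fin mulr_ge0 ?invsq_ge0//; have /andP[] := E0 t.
rewrite integral_invsq (ge0_integral_split T0)//; apply: leeD2l.
apply: (@le_trans _ _ (\int[mu]_(t in `]T, +oo[)
    (2%:E * ((t ^+ 2)^-1)%:E))%E).
  apply: ge0_le_integral => //.
  - exact: measurable_funTS.
  - apply: measurable_funTS; apply/measurable_EFinP/measurable_funM => //.
    exact: measurable_sqrV.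
  - move=> t; rewrite /= in_itv/= andbT => Tt.
    rewrite lee_fin invsqE ?(lt_trans T0)// ler_wpM2r ?invr_ge0 ?sqr_ge0//.
    by have /andP[] := E0 t.
rewrite ge0_integralZl_EFin//.
- rewrite integral_itv_obnd_cbnd ?integral_invsq_tail//.
  by apply: measurable_funTS; apply/measurable_EFinP; exact: measurable_sqrV.
- by move=> t _; rewrite lee_fin invr_ge0 sqr_ge0.
- by apply: measurable_funTS; apply/measurable_EFinP; exact: measurable_sqrV.
Qed.

(** The cube beats the singularity of the kernel: [t ^+ 3 / t ^+ 2 = t], and [t exp (- t^2 / 4)] has
    integral at most [2] on []0, T]]. *)
Lemma integral_invsq_le (E : R -> R) (C T : R) : 0 < T -> 0 <= C ->
  measurable_fun [set: R] E -> (forall t, 0 <= E t <= 2) ->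
  (forall t, 0 < t <= T -> E t <= C * t ^+ 3 * expR (- t ^+ 2 / 4)) ->
  (\int[mu]_t (E t * invsq t)%:E <= (2 * C + 2 / T)%:E)%E.
Proof.
move=> T0 C0 mE E0 EC.
apply: le_trans (integral_invsq_le_head T0 mE E0) _.
rewrite EFinD; apply: leeD2r.
apply: (@le_trans _ _ (\int[mu]_(t in `]0%R, T])
    (C%:E * (t * expR (- t ^+ 2 / 4))%:E))%E); last first.
  rewrite ge0_integralZl_EFin//.
  - by rewrite mulrC EFinM lee_wpmul2l ?lee_fin// integral_id_gauss.
  - move=> t; rewrite /= in_itv/= => /andP[t0 _].
    by rewrite lee_fin mulr_ge0 ?expR_ge0 ?ltW.
  - apply: measurable_funTS; apply/measurable_EFinP/measurable_funM => //.
    apply: measurableT_comp => //; apply: measurable_funM => //.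
    by apply: measurableT_comp => //; exact: measurable_funX.
apply: ge0_le_integral => //.
- by move=> t _; rewrite lee_fin mulr_ge0 ?invsq_ge0//; have /andP[] := E0 t.
- apply: measurable_funTS; apply/measurable_EFinP/measurable_funM => //.
  exact: measurable_invsq.
- apply: measurable_funTS; apply/measurable_EFinP/measurable_funM => //.
  apply: measurable_funM => //.
  apply: measurableT_comp => //; apply: measurable_funM => //.
  by apply: measurableT_comp => //; exact: measurable_funX.
- move=> t; rewrite /= in_itv/= => /andP[t0 tT].
  rewrite lee_fin invsqE// ler_pdivrMr ?exprn_gt0//.
  apply: le_trans (EC _ _) _; first by rewrite t0.
  by rewrite le_eqVlt; apply/orP; left; apply/eqP; ring.
Qed.

End inverse_square_kernel.

Section absolute_value_kernel.
Context {R : realType}.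
Implicit Types (x y t T : R).
Local Notation mu := (@lebesgue_measure R).

(* [1 / 2] is the limit at [0], where [invsq] takes the junk value [0]. *)
Definition cos_kernel t : R := if t == 0 then 1 / 2 else (1 - cos t) / t ^+ 2.

Lemma one_sub_cos_ge t : 0 <= t -> t ^+ 2 / 2 - t ^+ 3 / 6 <= 1 - cos t.
Proof.
move=> t0; rewrite -subr_ge0.
rewrite -[leLHS](_ : 1 - cos 0 - (0 * 0 / 2 - 0 * 0 * 0 / 6) = 0 :> R); last first.
  by rewrite cos0; lra.
rewrite [leRHS](_ : _ = 1 - cos t - (t * t / 2 - t * t * t / 6)); last by ring.
apply: (@is_derive_ge0_le _ (fun y => 1 - cos y - (y * y / 2 - y * y * y / 6))
  (fun y => y ^+ 2 / 2 - (y - sin y)) 0 t) => //.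
  by move=> x; derive_eq; [solve_derive|cbv beta; field].
by move=> x /andP[x0 _]; rewrite subr_ge0 id_sub_sin_le.
Qed.

Lemma cos_kernel_ge0 t : 0 <= cos_kernel t.
Proof.
rewrite /cos_kernel; case: ifP => _; first by rewrite divr_ge0.
by rewrite divr_ge0 ?sqr_ge0// subr_ge0 cos_le1.
Qed.

Lemma cos_kernel_bounds t : 0 <= t -> 1 / 2 - t / 6 <= cos_kernel t <= 1 / 2.
Proof.
move=> t0; rewrite /cos_kernel; case: (eqVneq t 0) => [->|tn0].
  by apply/andP; split; lra.
have tp : 0 < t by rewrite lt_neqAle eq_sym tn0.
rewrite ler_pdivlMr ?ler_pdivrMr ?exprn_gt0//.
have := one_sub_cos_ge t0; have := one_sub_cos_le t0 => h1 h2.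
by apply/andP; split; lra.
Qed.

(** Continuity up to [0] is what the change of variables on the closed half-line requires; at [0] it
    follows by squeezing with [cos_kernel_bounds]. *)
Lemma continuous_cos_kernel : {within `[0, +oo[, continuous cos_kernel}.
Proof.
apply/continuous_within_itvcyP; split.
  move=> x; rewrite in_itv/= andbT => x0.
  have dk : is_derive x 1 (fun t => (1 - cos t) * (t * t)^-1)
      ((1 - cos x) * (- (x * x) ^- 2 *: (x * 1 + x * 1)) +
       (x * x)^-1 * (0 + - (- sin x * 1))).
    notypeclasses refine (is_derive_mul _ _); first solve_derive.
    notypeclasses refine (is_deriveV _ _); last solve_derive.
    by rewrite mulf_neq0// gt_eqF.
  have ck : {for x, continuous (fun t => (1 - cos t) * (t * t)^-1)}.
    by have [+ _] := dk => /derivable1_diffP/differentiable_continuous.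
  have kE : {near x, (fun t => (1 - cos t) * (t * t)^-1) =1 cos_kernel}.
    near=> t; rewrite /cos_kernel ifF ?expr2//; apply/negbTE.
    by rewrite gt_eqF//; near: t; exact: lt_nbhsr.
  rewrite /continuous_at -(nbhs_singleton kE).
  by apply: cvg_trans ck; exact: near_eq_cvg.
have k0 : cos_kernel 0 = 1 / 2 by rewrite /cos_kernel eqxx.
rewrite k0.
have c1 : (fun t => 1 / 2 - t / 6 : R) @ 0^'+ --> (1 / 2 : R).
  rewrite -[X in _ --> X](_ : 1 / 2 - 0 / 6 = 1 / 2 :> R); last lra.
  apply: cvg_at_right_filter; apply: cvgB; first exact: cvg_cst.
  by apply: cvgMl; exact: cvg_id.
apply: (squeeze_cvgr _ c1 (cvg_cst _)).
near=> t; apply: cos_kernel_bounds.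
by near: t; exact: nbhs_right_ge.
Unshelve. all: end_near. Qed.

Lemma measurable_cos_kernel : measurable_fun (`]0, +oo[%classic : set R) cos_kernel.
Proof.
apply: open_continuous_measurable_fun => //.
by move: continuous_cos_kernel => /continuous_within_itvcyP[/in_continuous_mksetP].
Qed.

(** The exact value is [pi / 2], but the argument relies only on finiteness ([cos_constE], which
    justifies [fine]) and on the lower bound [1 / 4]. *)
Definition cos_const : R := fine (\int[mu]_(t in `[0%R, +oo[) (cos_kernel t)%:E)%E.

Let cos_kernel_invsq t : 0 < t -> cos_kernel t = (1 - cos t) * invsq t.
Proof. by move=> t0; rewrite /cos_kernel gt_eqF// invsqE. Qed.

Let intE : (\int[mu]_(t in `[0%R, +oo[) (cos_kernel t)%:E =
  \int[mu]_t ((1 - cos t) * invsq t)%:E)%E.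
Proof.
rewrite integral_invsq -integral_itv_obnd_cbnd; last first.
  by apply/measurable_EFinP; exact: measurable_cos_kernel.
by apply: eq_integral => t; rewrite inE/= in_itv/= andbT => /cos_kernel_invsq ->.
Qed.

Lemma measurable_one_sub_cosM y : measurable_fun [set: R] (fun t : R => 1 - cos (t * y)).
Proof.
apply: continuous_measurable_fun.
apply: (@is_derive_continuous _ _ (fun t => sin (t * y) * y)) => x.
by derive_eq; [solve_derive|cbv beta; ring].
Qed.

Lemma cos_constE :
  (\int[mu]_(t in `[0%R, +oo[) (cos_kernel t)%:E = cos_const%:E)%E.
Proof.
rewrite fineK// ge0_fin_numE; last first.
  by apply: integral_ge0 => t _; rewrite lee_fin cos_kernel_ge0.
rewrite intE; pose e t : R := 1 - cos t.
have e02 t : 0 <= e t <= 2.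
  have := cos_le1 t; have := cos_geN1 t; rewrite /e => h1 h2.
  by apply/andP; split; lra.
have me : measurable_fun [set: R] e.
  by have := measurable_one_sub_cosM 1; under eq_fun do rewrite mulr1.
apply: le_lt_trans (integral_invsq_le_head ltr01 me e02) _.
rewrite lte_add_pinfty ?ltry//.
apply: (@le_lt_trans _ _ (\int[mu]_(t in `]0%R, 1%R]) (cst (1 / 2)%:E t))%E).
  apply: ge0_le_integral => //.
  - by move=> t _; rewrite lee_fin mulr_ge0 ?invsq_ge0//; have /andP[] := e02 t.
  - apply: measurable_funTS; apply/measurable_EFinP/measurable_funM => //.
    exact: measurable_invsq.
  - move=> t; rewrite /= in_itv/= => /andP[t0 _].
    by rewrite lee_fin -cos_kernel_invsq//; have /andP[] := cos_kernel_bounds (ltW t0).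
rewrite integral_cst//= lebesgue_measure_itv/= lte_fin ltr01.
by rewrite -EFinB -EFinM ltry.
Qed.

(** On []0, 1]] the kernel is at least [1 / 2 - 1 / 6], which exceeds [1 / 4]. *)
Lemma cos_const_ge : 1 / 4 <= cos_const.
Proof.
rewrite -lee_fin -cos_constE.
apply: (@le_trans _ _ (\int[mu]_(t in `]0%R, 1%R]) (cst (1 / 4)%:E t))%E).
  rewrite integral_cst//= lebesgue_measure_itv/= lte_fin ltr01.
  by rewrite -EFinB -EFinM lee_fin; lra.
rewrite -integral_itv_obnd_cbnd; last by apply/measurable_EFinP; exact: measurable_cos_kernel.
have sub : `]0%R, 1%R]%classic `<=` (`]0%R, +oo[%classic : set R).
  by move=> t; rewrite /= !in_itv/= andbT => /andP[].
apply: (@le_trans _ _ (\int[mu]_(t in `]0%R, 1%R]) (cos_kernel t)%:E)%E).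
  apply: ge0_le_integral => //.
  - by move=> t _; rewrite lee_fin; lra.
  - apply: measurable_funS sub _ => //.
    by apply/measurable_EFinP; exact: measurable_cos_kernel.
  - move=> t; rewrite /= in_itv/= => /andP[t0 t1].
    by rewrite lee_fin; have /andP[+ _] := cos_kernel_bounds (ltW t0); lra.
apply: ge0_subset_integral => //.
- by apply/measurable_EFinP; exact: measurable_cos_kernel.
- by move=> t _; rewrite lee_fin cos_kernel_ge0.
Qed.

(** The substitution of [t * y] for [t] scales the kernel by [y] when [y] is positive; parity of
    [cos] covers negative [y]. *)
Lemma integral_one_sub_cos y :
  (\int[mu]_t ((1 - cos (t * y)) * invsq t)%:E = (cos_const * `|y|)%:E)%E.
Proof.
wlog y0 : y / 0 < y.
  move=> H; have [|y0|<-] := ltgtP 0 y; first exact: H.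
    rewrite -normrN -H ?oppr_gt0//; apply: eq_integral => t _.
    by rewrite mulrN cosN.
  rewrite normr0 mulr0 -[RHS](integral0 mu setT); apply: eq_integral => t _.
  by rewrite mulr0 cos0 subrr mul0r.
rewrite gtr0_norm// mulrC EFinM -cos_constE.
pose F t : R := t * y.
have dF (x : R) : is_derive x 1 F y.
  by derive_eq; [rewrite /F; solve_derive|cbv beta; ring].
have F'E : F^`()%classic = cst y.
  by apply/funext => x; rewrite derive1E; have [] := dF x.
have F0 : F 0 = 0 by rewrite /F mul0r.
have cF := is_derive_continuous dF.
have := @increasing_ge0_integration_by_substitutiony _ F cos_kernel 0.
rewrite F0 F'E => ->; first last.
- by move=> x _; exact: cos_kernel_ge0.
- exact: continuous_cos_kernel.
- by apply: gt0_cvgMly => //; exact: cvg_id.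
- split; first by move=> x _; have [] := dF x.
  by apply: cvg_at_right_filter; exact: cF.
- exact: is_cvg_cst.
- exact: is_cvg_cst.
- by move=> x _; exact: cvg_cst.
- by move=> a b _ _ ab; rewrite /F ltr_pM2r.
have mk : measurable_fun (`]0, +oo[%classic : set R) (fun x => (cos_kernel (F x) * y)%:E).
  apply/measurable_EFinP; apply: measurable_funM => //.
  apply: (measurable_comp _ _ measurable_cos_kernel) => //.
    move=> _ [x /= + <-]; rewrite !in_itv/= !andbT => x0.
    by rewrite /F mulr_gt0.
  by apply: measurable_funTS; exact: continuous_measurable_fun.
rewrite -[X in (_ * X)%E](integral_itv_obnd_cbnd mk) -ge0_integralZl_EFin ?ltW//.
- rewrite integral_invsq; apply: eq_integral => t.
  rewrite inE/= in_itv/= andbT => t0; rewrite -EFinM; congr EFin.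
  rewrite /= invsqE// /F /cos_kernel mulf_eq0 !gt_eqF//= exprMn.
  by field; rewrite !gt_eqF.
- by move=> t _; rewrite lee_fin mulr_ge0 ?cos_kernel_ge0// ltW.
Qed.

End absolute_value_kernel.

(** * Mean distances of a Gaussian variable *)

Section gaussian_moments.
Context {R : realType}.
Implicit Types (a x z t h : R).
Local Notation mu := (@lebesgue_measure R).
Local Notation s2pi := (Num.sqrt (2 * pi) : R).

Lemma gauss_le1 z : gauss z <= 1.
Proof. by rewrite /gauss -expR0 ler_expR mulNr oppr_le0 divr_ge0// sqr_ge0. Qed.

Lemma integrable_gauss : mu.-integrable setT (EFin \o gauss).
Proof. exact: integrable_expR_sqr. Qed.

Lemma measurable_gauss : measurable_fun [set: R] gauss.
Proof. by apply: continuous_measurable_fun; exact: continuous_gauss. Qed.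

Lemma integrable_dist_gauss a :
  mu.-integrable setT (EFin \o fun z => `|z - a| * gauss z).
Proof.
have i1 : mu.-integrable setT
    (fun z => ((expR (- z ^+ 2 / 4))%:E + `|a|%:E * (gauss z)%:E)%E).
  apply: integrableD => //; first exact: integrable_expR_sqr.
  by apply: integrableZl => //; exact: integrable_gauss.
apply: (le_integrable _ _ _ i1) => //.
  apply/measurable_EFinP; apply: measurable_funM; last exact: measurable_gauss.
  by apply: measurableT_comp => //; exact: measurable_funB.
move=> z _; rewrite -EFinM -EFinD /= lee_fin ger0_norm; last first.
  by rewrite mulr_ge0// gauss_ge0.
rewrite [leRHS]ger0_norm; last by rewrite addr_ge0 ?expR_ge0 ?mulr_ge0 ?gauss_ge0.
apply: le_trans (lerD (abs_gauss_le z) (lexx _)).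
by rewrite -mulrDl ler_wpM2r ?gauss_ge0// ler_normB.
Qed.

(** This is [Num.sqrt (2 * pi)] times [E |Z - a|] for a standard normal [Z]. *)
Definition gauss_dist a : R := \int[mu]_z (`|z - a| * gauss z).

Let gauss_distE a :
  (\int[mu]_z (`|z - a| * gauss z)%:E = (gauss_dist a)%:E)%E.
Proof.
rewrite /gauss_dist /Rintegral fineK//.
exact: (integrable_fin_num measurableT (integrable_dist_gauss a)).
Qed.

Let one_sub_cos_gaussE t a :
  (\int[mu]_z ((1 - cos (t * (z - a))) * gauss z)%:E =
   (s2pi * (1 - cos (t * a) * gauss t))%:E)%E.
Proof.
have ic : mu.-integrable setT (EFin \o fun z => cos (t * z + - (t * a)) * gauss z).
  exact: integrable_cos_gauss.
rewrite (_ : (s2pi * _) = \int[mu]_z (gauss z - cos (t * z + - (t * a)) * gauss z)).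
  rewrite /Rintegral fineK.
    by apply: eq_integral => z _; rewrite mulrBl mul1r mulrBr.
  exact: (integrable_fin_num measurableT
    (integrableB measurableT integrable_gauss ic)).
rewrite RintegralB//; last exact: integrable_gauss.
by rewrite Rintegral_gauss Rintegral_cos_gauss cosN; ring.
Qed.

(** Tonelli for the nonnegative function [f]: integrating first in [t] produces
    [cos_const * |z - a|], integrating first in [z] produces the Fourier transform of the
    Gaussian. *)
Lemma gauss_dist_fourier a :
  (\int[mu]_t (s2pi * (1 - cos (t * a) * gauss t) * invsq t)%:E =
   (cos_const * gauss_dist a)%:E)%E.
Proof.
pose f (zt : R * R) : \bar R :=
  ((1 - cos (zt.2 * (zt.1 - a))) * invsq zt.2 * gauss zt.1)%:E.
have f0 zt : (0 <= f zt)%E.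
  by rewrite lee_fin mulr_ge0 ?gauss_ge0// mulr_ge0 ?invsq_ge0 ?subr_ge0 ?cos_le1.
have mf : measurable_fun setT f.
  apply/measurable_EFinP; apply: measurable_funM; last first.
    by apply: measurableT_comp => //; exact: measurable_gauss.
  apply: measurable_funM; last first.
    by apply: measurableT_comp => //; exact: measurable_invsq.
  apply: measurable_funB => //.
  apply: (@measurableT_comp _ _ _ _ _ _ (@cos R)).
    by apply: continuous_measurable_fun; exact: continuous_cos.
  by apply: measurable_funM => //; exact: measurable_funB.
rewrite EFinM -gauss_distE -ge0_integralZl_EFin//; first last.
- by rewrite (le_trans _ cos_const_ge)// divr_ge0.
- by apply: (measurable_int mu); exact: integrable_dist_gauss.
- by move=> z _; rewrite lee_fin mulr_ge0// gauss_ge0.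
have FT := @fubini_tonelli _ _ _ _ R mu mu f mf f0.
transitivity (\int[mu]_t \int[mu]_z f (z, t))%E; last first.
  rewrite -FT; apply: eq_integral => z _.
  transitivity ((\int[mu]_t ((1 - cos (t * (z - a))) * invsq t)%:E) *
      (gauss z)%:E)%E; last by rewrite integral_one_sub_cos -!EFinM mulrA.
  rewrite -ge0_integralZr.
  - by apply: eq_integral => t _; rewrite /f -EFinM.
  - exact: measurableT.
  - apply/measurable_EFinP; apply: measurable_funM; last exact: measurable_invsq.
    exact: measurable_one_sub_cosM.
  - by move=> t _; rewrite lee_fin mulr_ge0 ?invsq_ge0 ?subr_ge0 ?cos_le1.
  - by rewrite lee_fin gauss_ge0.
apply: eq_integral => t _.
rewrite EFinM -one_sub_cos_gaussE -ge0_integralZr.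
- by apply: eq_integral => z _; rewrite /f -EFinM mulrAC.
- exact: measurableT.
- apply/measurable_EFinP; apply: measurable_funM; last exact: measurable_gauss.
  apply: continuous_measurable_fun.
  apply: (@is_derive_continuous _ _ (fun z => sin (t * (z - a)) * t)) => z.
  by derive_eq; [solve_derive|cbv beta; ring].
- by move=> z _; rewrite lee_fin mulr_ge0 ?gauss_ge0 ?subr_ge0 ?cos_le1.
- by rewrite lee_fin invsq_ge0.
Qed.

End gaussian_moments.

(** * Smoothing *)

Section gaussian_cdf.
Context {R : realType}.
Implicit Types (a x z t h : R).
Local Notation mu := (@lebesgue_measure R).
Local Notation s2pi := (Num.sqrt (2 * pi) : R).

(* [h^-1 (|z - (x + h)| - |z - x|)] interpolates affinely between the values
   [1] on [z <= x] and [-1] on [x + h <= z]. *)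
Lemma dist_ramp x z h : 0 < h ->
  `|z - x| + 2 * h * (z <= x)%R%:R <= `|z - (x + h)| + h <=
  `|z - x| + 2 * h * (z <= x + h)%R%:R.
Proof.
move=> h0; have [zx|zx] := leP z x.
  have zxh : z <= x + h by rewrite (le_trans zx)// lerDl ltW.
  have -> : `|z - x| = x - z by rewrite ler0_norm ?subr_le0// opprB.
  have -> : `|z - (x + h)| = x + h - z by rewrite ler0_norm ?subr_le0// opprB.
  by rewrite zxh /= !mulr1n; apply/andP; split; lra.
have -> : `|z - x| = z - x by rewrite gtr0_norm ?subr_gt0.
have [zxh|zxh] := leP z (x + h).
  have -> : `|z - (x + h)| = x + h - z by rewrite ler0_norm ?subr_le0// opprB.
  by rewrite /= mulr0n mulr1n; apply/andP; split; lra.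
have -> : `|z - (x + h)| = z - (x + h) by rewrite gtr0_norm ?subr_gt0.
by rewrite /= !mulr0n; apply/andP; split; lra.
Qed.

Let indic_le x z : (\1_(`]-oo, x]%classic) z : R) = (z <= x)%R%:R.
Proof.
rewrite indicE; congr (_%:R : R); apply: congr1.
by apply/idP/idP; rewrite inE/= in_itv.
Qed.

Let integrable_le_gauss x :
  mu.-integrable setT (EFin \o fun z => (z <= x)%R%:R * gauss z).
Proof.
apply: (le_integrable _ _ _ integrable_gauss) => //.
  apply/measurable_EFinP; apply: measurable_funM; last exact: measurable_gauss.
  rewrite (_ : (fun z => _) = \1_(`]-oo, x]%classic)); last first.
    by apply/funext => z; rewrite indic_le.
  by apply: measurable_indic; exact: measurable_itv.
move=> z _; rewrite lee_fin normrM [leRHS]ger0_norm ?gauss_ge0//.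
rewrite [`|gauss z|]ger0_norm ?gauss_ge0// ler_piMl ?gauss_ge0//.
by rewrite normr_nat lern1 leq_b1.
Qed.

Lemma gauss_cdfE x : s2pi * gauss_cdf x = \int[mu]_z ((z <= x)%R%:R * gauss z).
Proof.
rewrite /gauss_cdf mulrA mulfV ?mul1r; last by rewrite gt_eqF// sqrt2pi_gt0.
rewrite Rintegral_mkcond; apply: eq_Rintegral => z _.
rewrite patchE; case: ifPn; rewrite ?inE ?notin_setE/= in_itv/=.
  by move=> ->; rewrite mul1r.
by move/negP/negbTE ->; rewrite mul0r.
Qed.

Lemma gauss_cdf_itv01 x : 0 <= gauss_cdf x <= 1.
Proof.
apply/andP; split.
  rewrite -(pmulr_rge0 _ sqrt2pi_gt0) gauss_cdfE.
  by apply: Rintegral_ge0 => z _; rewrite mulr_ge0// gauss_ge0.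
rewrite -(ler_pM2l sqrt2pi_gt0) mulr1 gauss_cdfE.
rewrite -Rintegral_gauss; apply: le_Rintegral => //; first exact: integrable_gauss.
by move=> z _; rewrite ler_piMl ?gauss_ge0// lern1 leq_b1.
Qed.

Let integrableZ (f : R -> R) (k : R) : mu.-integrable setT (EFin \o f) ->
  mu.-integrable setT (EFin \o fun z => k * f z).
Proof. by move=> i; exact: (integrableZl measurableT k i). Qed.

Let integrableA (f g : R -> R) : mu.-integrable setT (EFin \o f) ->
  mu.-integrable setT (EFin \o g) ->
  mu.-integrable setT (EFin \o fun z => f z + g z).
Proof. by move=> i j; exact: (integrableD measurableT i j). Qed.

Let Rintegral_comb x (k : R) (y : R) :
  \int[mu]_z (`|z - x| * gauss z + k * ((z <= y)%R%:R * gauss z)) =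
  gauss_dist x + k * (s2pi * gauss_cdf y).
Proof.
rewrite RintegralD//; first last.
- exact: integrableZ.
- exact: integrable_dist_gauss.
by rewrite RintegralZl// gauss_cdfE.
Qed.

(** The pointwise inequalities [dist_ramp], integrated against [gauss]. *)
Lemma gauss_dist_ramp x h : 0 < h ->
  gauss_dist x + 2 * h * (s2pi * gauss_cdf x) <= gauss_dist (x + h) + h * s2pi <=
  gauss_dist x + 2 * h * (s2pi * gauss_cdf (x + h)).
Proof.
move=> h0.
have -> : gauss_dist (x + h) + h * s2pi =
    \int[mu]_z (`|z - (x + h)| * gauss z + h * gauss z).
  rewrite RintegralD//; first last.
  - by apply: integrableZ; exact: integrable_gauss.
  - exact: integrable_dist_gauss.
  by rewrite RintegralZl// ?Rintegral_gauss//; exact: integrable_gauss.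
have i1 y : mu.-integrable setT
    (EFin \o fun z => `|z - x| * gauss z + 2 * h * ((z <= y)%R%:R * gauss z)).
  by apply: integrableA; [exact: integrable_dist_gauss|exact: integrableZ].
have i2 : mu.-integrable setT
    (EFin \o fun z => `|z - (x + h)| * gauss z + h * gauss z).
  apply: integrableA; first exact: integrable_dist_gauss.
  by apply: integrableZ; exact: integrable_gauss.
have rampP z := dist_ramp x z h0.
rewrite -!Rintegral_comb; apply/andP; split; apply: le_Rintegral => // z _;
  rewrite mulrA -!mulrDl ler_wpM2r ?gauss_ge0//; by have /andP[] := rampP z.
Qed.

(** The normal density is at most [1], because [gauss <= 1 <= Num.sqrt (2 * pi)]. This converts the
    shift by [h] in the ramp into an error [h]. *)
Lemma gauss_cdf_lip x h : 0 <= h -> gauss_cdf (x + h) <= gauss_cdf x + h.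
Proof.
move=> h0.
have s1 : 1 <= s2pi.
  rewrite -[leLHS]sqrtr1 ler_sqrt ?mulr_ge0 ?pi_ge0//.
  by have := pi_ge2 R; lra.
rewrite -(ler_pM2l sqrt2pi_gt0) [leRHS]mulrDr [leLHS]gauss_cdfE [s2pi * gauss_cdf x]gauss_cdfE.
apply: (@le_trans _ _ (\int[mu]_z ((z <= x)%R%:R * gauss z) + h)); last first.
  by rewrite lerD2l ler_peMl.
rewrite -lerBlDl -RintegralB//.
have i3 : mu.-integrable setT (EFin \o (\1_(`]x, (x + h)]%classic) : R -> R)).
  apply/integrableP; split.
    by apply/measurable_EFinP; apply: measurable_indic; exact: measurable_itv.
  under eq_integral do rewrite /= ger0_norm//.
  rewrite integral_indic//= setIT.
  by rewrite lebesgue_measure_itv/=; case: ifP => _; exact: ltry.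
apply: (@le_trans _ _ (\int[mu]_z (\1_(`]x, (x + h)]%classic) z))).
  apply: le_Rintegral => //.
    exact: (integrableB measurableT (integrable_le_gauss _) (integrable_le_gauss _)).
  move=> z _; rewrite indicE -mulrBl.
  have -> : (z \in `]x, (x + h)]%classic) = (x < z) && (z <= x + h).
    by apply/idP/idP; rewrite inE/= in_itv.
  have [zx|zx] := leP z x.
    have -> : z <= x + h by rewrite (le_trans zx)// lerDl.
    by rewrite subrr mul0r.
  by case: (z <= x + h); rewrite subr0 ?mul1r ?mul0r ?gauss_le1.
rewrite /Rintegral integral_indic//= setIT.
rewrite lebesgue_measure_itv/= lte_fin; case: ifP => _ //=.
by rewrite addrAC subrr add0r.
Qed.

End gaussian_cdf.

Section smoothing.
Context {R : realType}.
Variables (n : nat) (p y : 'I_n -> R) (C T : R).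
Hypothesis p0 : forall i, 0 <= p i.
Hypothesis p1 : \sum_i p i = 1.
Hypotheses (C0 : 0 <= C) (T0 : 0 < T).
Hypothesis charP : forall t a, 0 < t <= T ->
  `|\sum_i p i * cos (t * (y i - a)) - cos (t * a) * gauss t| <=
  C * t ^+ 3 * expR (- t ^+ 2 / 4).
Local Notation mu := (@lebesgue_measure R).
Local Notation s2pi := (Num.sqrt (2 * pi) : R).

Let dist a := \sum_i p i * `|y i - a|.
Let cdf x := \sum_i p i * (y i <= x)%R%:R.
Let cy a t := \sum_i p i * cos (t * (y i - a)).
Let err a t := `|cy a t - cos (t * a) * gauss t|.

Let c0 : 0 <= cos_const :> R.
Proof. by rewrite (le_trans _ cos_const_ge)// divr_ge0. Qed.

Let measurable_cy a : measurable_fun [set: R] (cy a).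
Proof.
apply: continuous_measurable_fun.
apply: (@is_derive_continuous _ _
  (fun t => \sum_i p i * (- sin (t * (y i - a)) * (y i - a)))) => x.
apply: is_derive_bigsum => i.
by derive_eq; [solve_derive|cbv beta; ring].
Qed.

Let measurable_cg a : measurable_fun [set: R] (fun t => cos (t * a) * gauss t).
Proof.
apply: measurable_funM; last exact: measurable_gauss.
apply: (@measurableT_comp _ _ _ _ _ _ (@cos R)).
  by apply: continuous_measurable_fun; exact: continuous_cos.
exact: measurable_funM.
Qed.

Let cy_norm a t : `|cy a t| <= 1.
Proof.
apply: le_trans (ler_norm_sum _ _ _) _; rewrite -p1; apply: ler_sum => i _.
by rewrite normrM ger0_norm// ler_piMr// cos_max.
Qed.

Let cg_norm (a t : R) : `|cos (t * a) * gauss t| <= 1.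
Proof.
rewrite normrM [`|gauss t|]ger0_norm ?gauss_ge0//.
by rewrite mulr_ile1 ?gauss_ge0 ?gauss_le1 ?cos_max.
Qed.

Let int_err a : (\int[mu]_t (err a t * invsq t)%:E <= (2 * C + 2 / T)%:E)%E.
Proof.
apply: integral_invsq_le => //.
- apply: measurableT_comp => //.
  by apply: measurable_funB; [exact: measurable_cy|exact: measurable_cg].
- move=> t; rewrite normr_ge0/= (le_trans (ler_normB _ _))//.
  by have := cy_norm a t; have := cg_norm a t; lra.
- by move=> t; exact: charP.
Qed.

Let int_dist a : (\int[mu]_t ((1 - cy a t) * invsq t)%:E = (cos_const * dist a)%:E)%E.
Proof.
transitivity (\int[mu]_t (\sum_(i <- index_enum 'I_n)
    (p i * ((1 - cos (t * (y i - a))) * invsq t))%:E))%E.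
  apply: eq_integral => t _; rewrite sumEFin; congr EFin.
  rewrite -[1 in LHS]p1 /cy -sumrB mulr_suml; apply: eq_bigr => i _; ring.
have mi i : measurable_fun [set: R]
    (fun t : R => (1 - cos (t * (y i - a))) * invsq t).
  apply: measurable_funM; last exact: measurable_invsq.
  exact: measurable_one_sub_cosM.
have i0 i t : 0 <= (1 - cos (t * (y i - a))) * invsq t.
  by rewrite mulr_ge0 ?invsq_ge0 ?subr_ge0 ?cos_le1.
rewrite ge0_integral_sum//; first last.
- by move=> i t _; rewrite lee_fin mulr_ge0.
- move=> i; apply/measurable_EFinP.
  by apply: measurable_funM; [exact: measurable_cst|exact: mi].
rewrite mulr_sumr -sumEFin; apply: eq_bigr => i _.
under eq_integral do rewrite EFinM.
rewrite ge0_integralZl_EFin.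
- by rewrite integral_one_sub_cos -EFinM mulrCA.
- exact: measurableT.
- by move=> t _; rewrite lee_fin.
- by apply/measurable_EFinP; exact: mi.
- exact: p0.
Qed.

Let int_gauss a : (\int[mu]_t ((1 - cos (t * a) * gauss t) * invsq t)%:E =
  (cos_const * (gauss_dist a / s2pi))%:E)%E.
Proof.
have -> : cos_const * (gauss_dist a / s2pi) = s2pi^-1 * (cos_const * gauss_dist a).
  by ring.
have s0 : 0 < s2pi by exact: sqrt2pi_gt0.
have g0 t : 0 <= 1 - cos (t * a) * gauss t.
  by rewrite subr_ge0 (le_trans (ler_norm _)).
rewrite EFinM -gauss_dist_fourier -ge0_integralZl_EFin//.
- apply: eq_integral => t _; rewrite -EFinM; congr EFin.
  by rewrite !mulrA mulVf ?gt_eqF// mul1r.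
- by move=> t _; rewrite lee_fin mulr_ge0 ?invsq_ge0// mulr_ge0// ltW.
- apply/measurable_EFinP; apply: measurable_funM; last exact: measurable_invsq.
  apply: measurable_funM; first exact: measurable_cst.
  exact: (measurable_funB (measurable_cst _) (measurable_cg a)).
Qed.

(** Both mean distances are integrals against [invsq], so [cos_const] times their difference is at
    most the integral of [err]. The factor [4] comes from [cos_const_ge]. *)
Let dist_close a : `|dist a - gauss_dist a / s2pi| <= 4 * (2 * C + 2 / T).
Proof.
set B := 2 * C + 2 / T.
suff h : `|cos_const * dist a - cos_const * (gauss_dist a / s2pi)| <= B.
  have B0 : 0 <= B by exact: le_trans h.
  move: h; rewrite -mulrBr normrM (ger0_norm c0) => h.
  have := ler_wpM2r (normr_ge0 (dist a - gauss_dist a / s2pi)) (@cos_const_ge R).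
  lra.
have me : measurable_fun [set: R] (fun t => (err a t * invsq t)%:E).
  apply/measurable_EFinP; apply: measurable_funM; last exact: measurable_invsq.
  apply: measurableT_comp => //.
  by apply: measurable_funB; [exact: measurable_cy|exact: measurable_cg].
have e0 t : (0 <= (err a t * invsq t)%:E)%E.
  by rewrite lee_fin; apply: mulr_ge0; [exact: normr_ge0|exact: invsq_ge0].
(* Stated for a generic pair so that it applies in both orders; adding [err] to one side keeps every
   integrand nonnegative and avoids subtracting extended reals. *)
have key (f g : R -> R) (u v : R) : measurable_fun [set: R] f ->
    measurable_fun [set: R] g -> (forall t, `|f t| <= 1) -> (forall t, `|g t| <= 1) ->
    (forall t, `|f t - g t| = err a t) ->
    (\int[mu]_t ((1 - f t) * invsq t)%:E = u%:E)%E ->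
    (\int[mu]_t ((1 - g t) * invsq t)%:E = v%:E)%E -> u <= v + B.
  move=> mf mg f1 g1 fg E1 E2; rewrite -lee_fin EFinD -E1 -E2.
  have ge0 (k : R -> R) t : (forall t, `|k t| <= 1) -> (0 <= ((1 - k t) * invsq t)%:E)%E.
    move=> k1; rewrite lee_fin mulr_ge0 ?invsq_ge0// subr_ge0.
    exact: le_trans (ler_norm _) (k1 t).
  have mk (k : R -> R) : measurable_fun [set: R] k ->
      measurable_fun [set: R] (fun t => ((1 - k t) * invsq t)%:E).
    move=> mk; apply/measurable_EFinP; apply: measurable_funM; last exact: measurable_invsq.
    exact: (measurable_funB (measurable_cst _) mk).
  apply: (@le_trans _ _ (\int[mu]_t (((1 - g t) * invsq t)%:E +
      (err a t * invsq t)%:E))%E).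
    apply: ge0_le_integral.
    - exact: measurableT.
    - by move=> t _; exact: ge0.
    - exact: mk.
    - by apply: emeasurable_funD => //; exact: mk.
    - move=> t _; rewrite -EFinD lee_fin -mulrDl ler_wpM2r ?invsq_ge0//.
      by rewrite -fg -normrN opprB; have := ler_norm (g t - f t); lra.
  rewrite ge0_integralD; first exact: leeD2l (int_err a).
  - exact: measurableT.
  - by move=> t _; exact: ge0.
  - exact: mk.
  - by move=> t _; exact: e0.
  - exact: me.
have k1 := key (cy a) (fun t => cos (t * a) * gauss t) _ _ (measurable_cy a)
  (measurable_cg a) (cy_norm a) (cg_norm a) (fun=> erefl) (int_dist a) (int_gauss a).
have k2 := key (fun t => cos (t * a) * gauss t) (cy a) _ _ (measurable_cg a)
  (measurable_cy a) (cg_norm a) (cy_norm a) (fun t => distrC _ _) (int_gauss a)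
  (int_dist a).
by rewrite ler_norml; apply/andP; split; lra.
Qed.

Lemma cdf_smoothing x h : 0 < h ->
  `|\sum_i p i * (y i <= x)%R%:R - gauss_cdf x| <= h + 4 * (2 * C + 2 / T) / h.
Proof.
move=> h0; rewrite -/(cdf x).
pose D := 4 * (2 * C + 2 / T); rewrite -/D.
have s0 : 0 < s2pi by exact: sqrt2pi_gt0.
pose gd a : R := gauss_dist a / s2pi.
have dc a : `|dist a - gd a| <= D by exact: dist_close.
have gramp z : gd z + 2 * h * gauss_cdf z <= gd (z + h) + h <=
    gd z + 2 * h * gauss_cdf (z + h).
  have E w k : (gd w + k) * s2pi = gauss_dist w + k * s2pi.
    by rewrite mulrDl /gd divfK ?gt_eqF.
  have /andP[r1 r2] := gauss_dist_ramp z h0.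
  by apply/andP; split; rewrite -(ler_pM2r s0) !E; lra.
have dramp z : dist z + 2 * h * cdf z <= dist (z + h) + h <=
    dist z + 2 * h * cdf (z + h).
  have E1 w : dist w + h = \sum_i p i * (`|y i - w| + h).
    under [RHS]eq_bigr do rewrite mulrDr.
    by rewrite big_split/= -mulr_suml p1 mul1r.
  have E2 w u : dist w + 2 * h * cdf u =
      \sum_i p i * (`|y i - w| + 2 * h * (y i <= u)%R%:R).
    rewrite /dist /cdf mulr_sumr -big_split/=; apply: eq_bigr => i _; ring.
  rewrite E1 !E2; apply/andP; split; apply: ler_sum => i _;
    rewrite ler_wpM2l//; by have /andP[] := dist_ramp z (y i) h0.
(* The ramp from [x] to [x + h] gives the upper bound on [cdf x], the ramp from [x - h] to [x] the
   lower one. Each compares two mean distances, which costs [2 * D]. *)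
have := dc x; have := dc (x + h); have := dc (x - h).
rewrite !ler_norml => /andP[h1 h2] /andP[h3 h4] /andP[h5 h6].
have /andP[h7 _] := dramp x; have /andP[_ h8] := dramp (x - h).
have /andP[_ h9] := gramp x; have /andP[h10 _] := gramp (x - h).
rewrite subrK in h8; have := gauss_cdf_lip x (ltW h0).
have := gauss_cdf_lip (x - h) (ltW h0); rewrite subrK in h10 *.
set G1 := gauss_cdf (x - h) in h10 *; set G2 := gauss_cdf (x + h) in h9 *.
move=> h11 h12.
have k1 : 2 * h * cdf x <= 2 * h * G2 + 2 * D by lra.
have k2 : 2 * h * G1 - 2 * D <= 2 * h * cdf x by lra.
have h2p : 0 < 2 * h by lra.
have DE : D / h = 2 * D / (2 * h) by field; rewrite gt_eqF.
have k3 : cdf x <= G2 + D / h.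
  by rewrite -(ler_pM2l h2p) mulrDr DE [2 * h * (_ / _)]mulrC divfK ?gt_eqF.
have k4 : G1 - D / h <= cdf x.
  by rewrite -(ler_pM2l h2p) mulrBr DE [2 * h * (_ / _)]mulrC divfK ?gt_eqF.
apply/andP; split; lra.
Qed.

End smoothing.

(** * Random variables with finite support *)

Section finite_support.
Context (R : realType) (d : measure_display) (T : measurableType d).
Variables (Pr : probability T R) (X : {RV Pr >-> R}).
Variables (N : nat) (p : nat -> R).
Hypothesis XP : forall m, (m <= N)%N -> Pr [set w | X w = m%:R] = (p m)%:E.
Hypothesis p1 : \sum_(m < N.+1) p m = 1.

Let F (m : nat) : set T := [set w | X w = m%:R].

Let mF (m : nat) : measurable (F m).
Proof.
rewrite -[F m]setTI; have := measurable_funPT X measurableT.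
by move=> /(_ [set m%:R]); apply; exact: measurable_set1.
Qed.

(** The weights sum to [1], so off a null set [X] takes a value in [0..N]; there [g (X w)] is a
    combination of the indicators of the events [F m]. *)
Lemma integral_finite_support (g : R -> R) :
  measurable_fun [set: T] (g \o X) ->
  (\int[Pr]_w (g (X w))%:E = (\sum_(m < N.+1) p m * g m%:R)%:E)%E.
Proof.
move=> mg; pose A := \big[setU/set0]_(m < N.+1) F m.
have mA : measurable A by apply: bigsetU_measurable => m _; exact: mF.
have PA : Pr A = 1%E.
  rewrite /A measure_bigsetU//.
    rewrite -p1 -sumEFin; apply: eq_bigr => m _.
    by apply: XP; rewrite -ltnS.
  by move=> i j _ _ [w []]; rewrite /F/= => -> /eqP; rewrite eqr_nat => /eqP.
have i1 (m : nat) : Pr.-integrable setT (EFin \o \1_(F m)).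
  exact: integrable_indic.
have iF (m : nat) : Pr.-integrable setT
    (fun w => ((g m%:R)%:E * (\1_(F m) w)%:E)%E).
  by apply: integrableZl => //; exact: i1.
rewrite (ae_eq_integral (fun w => \sum_(m < N.+1)
  ((g m%:R)%:E * (\1_(F m) w)%:E))%E).
- rewrite integral_sum; [|exact: measurableT|by move=> m; exact: iF].
  rewrite -sumEFin; apply: eq_bigr => m _.
  rewrite integralZl//; last exact: i1.
  rewrite mulrC EFinM; congr (_ * _)%E; rewrite integral_indic// setIT.
  by apply: XP; rewrite -ltnS.
- exact: measurableT.
- by apply/measurable_EFinP.
- by apply: emeasurable_sum => m; exact: (measurable_int Pr (iF m)).
- exists (~` A); split; first exact: measurableC.
    by have := probability_setC Pr mA; rewrite PA subee.
  apply: subsetC => w; rewrite /A -bigcup_mkord => -[i /= iN] /= Fi _.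
  have Xi : X w = i%:R := Fi.
  rewrite (bigD1 (Ordinal iN))//= big1 ?adde0.
    by rewrite indicE mem_set// mule1 Xi.
  move=> j ji; rewrite indicE memNset ?mule0// /F/= Xi => /eqP.
  by rewrite eqr_nat => /eqP ij; move: ji; rewrite -val_eqE /= ij eqxx.
Qed.

Lemma mean_finite_support : mean Pr X = \sum_(m < N.+1) p m * m%:R.
Proof.
by rewrite /mean expectation_def (@integral_finite_support id).
Qed.

Lemma var_finite_support :
  var Pr X = \sum_(m < N.+1) p m * (m%:R - mean Pr X) ^+ 2.
Proof.
rewrite /var /variance unlock unlock /=.
rewrite (_ : (\int[Pr]_w _)%E = (\int[Pr]_w ((fun r => (r - mean Pr X) ^+ 2) (X w))%:E)%E).
  rewrite (@integral_finite_support (fun r => (r - mean Pr X) ^+ 2))//.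
  apply: (@measurable_funX _ _ _ _ (fun w => X w - mean Pr X)).
  by apply: measurable_funB => //; exact: measurable_funPT.
by apply: eq_integral => w _; rewrite expr2 /mean unlock.
Qed.

Lemma std_cdf_finite_support x : std_cdf Pr X x =
  \sum_(m < N.+1) p m *
    ((m%:R - mean Pr X) / Num.sqrt (var Pr X) <= x)%R%:R.
Proof.
pose g (r : R) := (r - mean Pr X) / Num.sqrt (var Pr X).
pose S := [set w | g (X w) <= x].
have mgX : measurable_fun [set: T] (g \o X).
  apply: (@measurable_funM _ _ _ _ (fun w => X w - mean Pr X) (cst _)) => //.
  exact: (@measurable_funB _ _ _ _ X (cst _)).
have mS : measurable S.
  rewrite -[S]setTI; have := mgX measurableT.
  move=> /(_ `]-oo, x]%classic (measurable_itv _)).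
  by congr measurable; congr (_ `&` _); apply/seteqP; split => w /=; rewrite in_itv.
rewrite /std_cdf -/S -[S]setIT -(integral_indic Pr measurableT mS).
rewrite (_ : (\int[Pr]_w _)%E = (\int[Pr]_w ((fun r => (g r <= x)%R%:R : R) (X w))%:E)%E).
  rewrite (@integral_finite_support (fun r => (g r <= x)%R%:R))//.
  rewrite (_ : _ \o _ = \1_S); first exact: measurable_indic.
  apply/funext => w /=; rewrite indicE; congr (_%:R).
  by apply: congr1; apply/idP/idP; rewrite inE.
apply: eq_integral => w _; rewrite indicE; congr (_%:R)%:E.
by apply: congr1; apply/idP/idP; rewrite inE.
Qed.

End finite_support.

Ltac positivity := repeat first [ done | exact: ltr01 | apply: mulr_gt0
  | apply: exprn_gt0 | apply: addr_gt0 | rewrite invr_gt0 ].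

(** * Rescaling to unit variance *)

Section clt.
Variables (R : realType) (delta z0 : R) (N : nat) (P : {poly R}).
Variable zeta : 'I_N -> R[i].
Hypotheses (delta0 : 0 < delta) (z00 : 0 < z0).
Hypotheses (sP : size P = N.+1) (Pge0 : forall m, 0 <= P`_m) (PN : 0 < P`_N).
Hypothesis Pzeta : complex_roots P zeta.
Hypothesis zetaP : forall j, (delta%:C)%C <= `|(z0%:C)%C - zeta j|.
Hypothesis v0 : 0 < weight_var N P z0.

Local Notation kappa := (z0 / delta).
Local Notation p := (weight P z0).
Local Notation mu := (weight_mean N P z0).
Local Notation v := (weight_var N P z0).
Local Notation sigma := (Num.sqrt v).
Local Notation K := (2 * kappa * (1 + kappa) ^+ 2).
Local Notation L := (N%:R / sigma ^+ 3).

Let sigma0 : 0 < sigma. Proof. by rewrite sqrtr_gt0. Qed.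

Let kappa0 : 0 < kappa. Proof. exact: divr_gt0. Qed.

Let K0 : 0 < K.
Proof. by positivity. Qed.

Let sigma2 : sigma ^+ 2 = v. Proof. by rewrite sqr_sqrtr// ltW. Qed.

(** A positive variance excludes [N = 0] through [variance_le]. *)
Let N0 : 0 < N%:R :> R.
Proof.
have := lt_le_trans v0 (variance_le delta0 z00 sP PN Pzeta zetaP).
by rewrite pmulr_lgt0//; positivity.
Qed.

Let L0 : 0 < L. Proof. by positivity. Qed.

Lemma weight_ge0 m : 0 <= p m.
Proof.
have Pz0 : 0 <= P.[z0].
  rewrite horner_coef; apply: sumr_ge0 => i _.
  by apply: mulr_ge0 => //; apply/ltW; positivity.
apply: divr_ge0 => //; apply: mulr_ge0 => //.
by apply/ltW; positivity.
Qed.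

Let Lsigma : L * sigma * (kappa * (1 + kappa)) >= 1.
Proof.
have h := variance_le delta0 z00 sP PN Pzeta zetaP.
move: sigma sigma0 sigma2 => s s0 s2.
have -> : N%:R / s ^+ 3 * s * (kappa * (1 + kappa)) =
    N%:R * (kappa * (1 + kappa)) / s ^+ 2.
  by field; rewrite !gt_eqF.
by rewrite s2 ler_pdivlMr// mul1r.
Qed.

(** This is [char_dist] at [tau = t / sigma] with unit vector [(cos (t * a), sin (t * a))]. The
    range of [t] makes [y = K L t^3 / 3] at most [t^2 / 4], so [exp y - 1 <= y exp y] costs only
    half of the Gaussian exponent. *)
Lemma standardized_char t a : 0 < t <= (2 * K * L)^-1 ->
  `|\sum_(m < N.+1) p m * cos (t * ((m%:R - mu) / sigma - a)) -
    cos (t * a) * gauss t| <= K * L * t ^+ 3 * expR (- t ^+ 2 / 4).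
Proof.
move=> /andP[t0 tT].
have KLt : 2 * (K * L * t) <= 1.
  have k0 : 0 < 2 * K * L by positivity.
  move: tT; rewrite -(ler_pM2l k0) mulfV ?gt_eqF// => h.
  by apply: le_trans h; rewrite !mulrA.
pose tau := t / sigma.
have tau0 : 0 <= tau by rewrite divr_ge0 ?ltW.
have tau_le : 0 <= tau <= (2 * kappa)^-1.
  rewrite tau0/= /tau.
  have k0 : 0 < 2 * kappa by positivity.
  rewrite -(ler_pM2l k0) mulfV ?gt_eqF//.
  rewrite [leLHS]mulrA ler_pdivrMr// mul1r.
  have w0 : 0 < L * (kappa * (1 + kappa)) by positivity.
  (* From [2 K L t <= 1 <= L sigma kappa (1 + kappa)], after dividing by [L kappa (1 + kappa)]. *)
  have : 4 * (1 + kappa) * t <= sigma.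
    rewrite -(ler_pM2l w0).
    have -> : L * (kappa * (1 + kappa)) * (4 * (1 + kappa) * t) = 2 * (K * L * t).
      by ring.
    apply: le_trans KLt _; apply: le_trans Lsigma _.
    by rewrite le_eqVlt; apply/orP; left; apply/eqP; ring.
  have : 0 < kappa * t by positivity.
  lra.
have cs : cos (t * a) ^+ 2 + sin (t * a) ^+ 2 = 1 by rewrite cos2Dsin2.
have := char_dist delta0 z00 sP PN Pzeta zetaP tau_le cs.
have vt : v * tau ^+ 2 = t ^+ 2.
  by rewrite /tau exprMn exprVn sigma2 mulrC divfK// gt_eqF.
rewrite vt (_ : K * N%:R * tau ^+ 3 / 3 = K * L * t ^+ 3 / 3); last first.
  by rewrite /tau exprMn exprVn; ring.
have -> : expR (- (t ^+ 2 / 2)) = gauss t by rewrite /gauss mulNr.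
have -> : cos (t * a) * cos_part N P z0 tau + sin (t * a) * sin_part N P z0 tau =
    \sum_(m < N.+1) p m * cos (t * ((m%:R - mu) / sigma - a)).
  rewrite /cos_part /sin_part !mulr_sumr -big_split/=; apply: eq_bigr => m _.
  have -> : t * ((m%:R - mu) / sigma - a) = (m%:R - mu) * tau - t * a.
    by rewrite /tau; ring.
  by rewrite cosB; ring.
move=> /le_trans; apply.
set y := K * L * t ^+ 3 / 3.
have y0 : 0 <= y by apply/ltW; rewrite /y; positivity.
have yt : y <= t ^+ 2 / 4.
  rewrite (_ : y = K * L * t * (t ^+ 2 / 3)); last by rewrite /y; ring.
  have : K * L * t <= 1 / 2 by lra.
  move=> /(ler_wpM2r (_ : 0 <= t ^+ 2 / 3)) h.
  apply: le_trans (h _) _; first by rewrite divr_ge0// sqr_ge0.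
  by have := sqr_ge0 t; lra.
apply: (@le_trans _ _ (gauss t * (y * expR (t ^+ 2 / 4)))).
  rewrite ler_wpM2l ?gauss_ge0// (le_trans (expR_sub1_le _))//.
  by rewrite ler_wpM2l// ler_expR.
have -> : gauss t * (y * expR (t ^+ 2 / 4)) = y * expR (- t ^+ 2 / 4).
  by rewrite mulrCA /gauss -expRD; congr (_ * expR _); field.
rewrite ler_wpM2r ?expR_ge0// /y ler_pdivrMr//.
by rewrite ler_peMr ?ler1n//; apply/ltW; positivity.
Qed.

Lemma standardized_cdf x h : 0 < h ->
  `|\sum_(m < N.+1) p m * ((m%:R - mu) / sigma <= x)%R%:R - gauss_cdf x| <=
  h + 24 * K * L / h.
Proof.
move=> h0.
have T0 : 0 < (2 * K * L)^-1 by positivity.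
have C0 : 0 <= K * L by apply/ltW; positivity.
(* With [C = K L] and [T = (2 K L)^-1] the smoothing error [4 * (2 * C + 2 / T)] equals [24 K L]. *)
have := @cdf_smoothing R N.+1 (fun m => p m) (fun m => (m%:R - mu) / sigma)
  (K * L) (2 * K * L)^-1 (fun m => weight_ge0 m)
  (sum_weight delta0 sP PN Pzeta zetaP) C0 T0 (fun t a => @standardized_char t a) x h h0.
by rewrite invrK; congr (_ <= _); congr (_ + _ / _); ring.
Qed.

End clt.

Unset Implicit Arguments.

Theorem theorem2p1 (R : realType) (delta z0 : R) :
  0 < delta -> 0 < z0 -> delta <= z0 ->
  exists (N0 : nat) (B1 B2 : R),
    [/\ (0 < N0)%N, 0 < B1 & 0 < B2] /\
    forall (N : nat) (P : {poly R}) (zeta : 'I_N -> R[i])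
      (d : measure_display) (T : measurableType d)
      (Pr : probability T R) (X : {RV Pr >-> R}),
      (1 <= N)%N ->
      size P = N.+1 ->
      (forall m : nat, 0 <= P`_m) ->
      0 < P`_N ->
      complex_roots P zeta ->
      (forall j : 'I_N, (delta%:C)%C <= `|(z0%:C)%C - zeta j|) ->
      (forall m : nat, (m <= N)%N ->
         Pr [set w | X w = m%:R] = (P`_m * z0 ^+ m / P.[z0])%:E) ->
      0 < var Pr X ->
      (N0 <= N)%N ->
      (ereal_sup (range (fun x : R => `|std_cdf Pr X x - gauss_cdf x|%:E))
       <= (B1 * N%:R / (var Pr X) `^ (3 / 2)
           + B2 * N%:R `^ (1 / 3) / (var Pr X) `^ (1 / 2))%:E)%E.
Proof.
move=> delta0 z00 _; pose K := 2 * (z0 / delta) * (1 + z0 / delta) ^+ 2.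
have kappa0 : 0 < z0 / delta by positivity.
have K0 : 0 < K by rewrite /K; positivity.
(* The value of [B2] is what [standardized_cdf] yields at [h = e], namely [e + 24 K e^2], when
   [e <= 1]. *)
exists 1%N, 1, (1 + 24 * K); split; first by split => //; positivity.
move=> N P zeta d T Pr X N1 sP Pge0 PN Pzeta zetaP XP v0 _.
have {}XP m : (m <= N)%N -> Pr [set w | X w = m%:R] = (weight P z0 m)%:E.
  exact: XP.
have p1 := sum_weight delta0 sP PN Pzeta zetaP.
have mE : mean Pr X = weight_mean N P z0 := mean_finite_support XP p1.
have vE : var Pr X = weight_var N P z0.
  by rewrite (var_finite_support XP p1) mE.
have FE := std_cdf_finite_support XP p1.
rewrite mE vE in FE; rewrite vE in v0 *.
have := standardized_cdf delta0 z00 sP Pge0 PN Pzeta zetaP v0; rewrite -/K.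
have := weight_ge0 z00 Pge0.
move: (weight_var N P z0) v0 FE => v v0 FE p0 smooth.
have s0 : 0 < Num.sqrt v by rewrite sqrtr_gt0.
have N0 : 0 < N%:R :> R by rewrite ltr0n.
(* The cube root of [L], and at the same time the shape of the second term of the bound. *)
pose e := N%:R `^ (1 / 3) / Num.sqrt v.
have e0 : 0 < e by rewrite divr_gt0// powR_gt0.
have n3 : (N%:R `^ (1 / 3)) ^+ 3 = N%:R :> R.
  rewrite -powR_mulrn ?powR_ge0// -powRrM.
  have -> : 1 / 3 * 3%:R = 1 :> R by field.
  by rewrite powRr1// ltW.
have e3 : N%:R / Num.sqrt v ^+ 3 = e ^+ 3 by rewrite /e exprMn exprVn n3.
apply: ge_ereal_sup => _ [x _ <-]; rewrite lee_fin.
apply: (@le_trans _ _ ((1 + 24 * K) * e)); last first.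
  rewrite [1 / 2]div1r (powR12_sqrt (ltW v0)).
  have -> : (1 + 24 * K) * N%:R `^ (1 / 3) / Num.sqrt v = (1 + 24 * K) * e.
    by rewrite /e mulrA.
  rewrite lerDr; apply: divr_ge0; last exact: powR_ge0.
  by rewrite mul1r ltW.
(* For [e > 1] the bound exceeds [1], and two numbers in [[0, 1]] differ by at most [1]. *)
have [e1|e1] := leP e 1; last first.
  apply: (@le_trans _ _ 1); last first.
    have : 0 < K * e by positivity.
    by lra.
  have /andP[g0 g1] := gauss_cdf_itv01 x.
  have f0 : 0 <= std_cdf Pr X x.
    by rewrite FE; apply: sumr_ge0 => m _; rewrite mulr_ge0.
  have f1 : std_cdf Pr X x <= 1.
    rewrite FE -[leRHS]p1; apply: ler_sum => m _.
    by rewrite ler_piMr// lern1 leq_b1.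
  by rewrite ler_norml; apply/andP; split; lra.
have := smooth x _ e0; rewrite -FE e3 => /le_trans; apply.
have -> : 24 * K * e ^+ 3 / e = 24 * K * (e * e) by field; rewrite gt_eqF.
have K24 : 0 < 24 * K by positivity.
have : 24 * K * (e * e) <= 24 * K * e by rewrite (ler_pM2l K24) ler_piMr// ltW.
by lra.
Qed.
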